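(* Let $b\ge2$ and $0\le d<b$ be integers. Let $d_1=d$ if $d>0$ and $d_1=b$ if $d=0$. Then, for every integer $k\ge1$: $$I(b,d,k)=b\log(b)+\frac1b\int_{[0,1)}\psi\Bigl(\frac{d_1+x}b\Bigr)(\mu_k-\mu_{k-1})(dx),$$ and for $k=0$: $$I(b,d,0)=b\log(b)-\psi(1)+\frac1b\int_{[0,1)}\psi\Bigl(\frac{d_1+x}b\Bigr)\mu_0(dx).$$
   Context: For integers $b\ge 2$, $0\le d<b$ and $k\ge 0$, $I(b,d,k)=\sum \frac1m$, where the sum runs over all integers $m>0$ whose base-$b$ representation (without leading zeros) contains exactly $k$ occurrences of the digit $d$ (this series converges). $\psi=\Gamma'/\Gamma$ is the digamma function. Let $\mathsf D=\{0,\dots,b-1\}$. For a string $X=(d_l,\dots,d_1)\in\mathsf D^l$ of length $|X|=l\ge0$ put $n(X)=d_lb^{l-1}+\dots+d_1b^0$ and $x(X)=n(X)/b^{l}\in[0,1)$ (with $x(X)=0$ for the empty string). The measure $\mu_k$ (depending also on $b$ and $d$) on $[0,1)$ is $\mu_k=\sum_X b^{-|X|}\delta_{x(X)}$, the sum being over all strings $X$ (of all lengths $l\ge 0$) that contain exactly $k$ occurrences of the digit $d$; leading zeros count as digits of the string. It is a finite measure of total mass $b$. *)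

(* Defs.v *)
From HB Require Import structures.
From mathcomp Require Import all_boot all_order all_algebra.
From mathcomp Require Import all_classical all_reals all_analysis.

Set Implicit Arguments.
Unset Strict Implicit.
Unset Printing Implicit Defensive.

Import Order.TTheory GRing.Theory Num.Theory.
Import numFieldNormedType.Exports.

Local Open Scope classical_set_scope.
Local Open Scope ring_scope.

Section Digamma.
Variable R : realType.

(* Euler's integral: the Gamma function for x > 0 only. *)
Definition Gamma (x : R) : R :=
  \int[lebesgue_measure]_(t in `]0, +oo[) (t `^ (x - 1) * expR (- t)).

Definition digamma (x : R) : R := derive1 Gamma x / Gamma x.

End Digamma.

(* Least significant digit first; there are no leading zeros when 1 < b and
   0 < m, as the representation then has (trunc_log b m).+1 digits. *)
Definition digits (b m : nat) : seq nat :=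
  [seq ((m %/ b ^ i) %% b)%N | i <- iota 0 (trunc_log b m).+1].

Definition kempner_sum (R : realType) (b d k : nat) : \bar R :=
  \esum_(m in [set m : nat | (0 < m)%N /\ count_mem d (digits b m) = k])
    (m%:R^-1)%:E.

(* The head of a string is its most significant digit, hence the [rev]. *)
Definition string_value (b : nat) (X : seq 'I_b) : nat :=
  (\sum_(i < size X) nth 0 [seq val c | c <- rev X] i * b ^ i)%N.

Definition string_point (R : realType) (b : nat) (X : seq 'I_b) : R :=
  (string_value X)%:R / b%:R ^+ size X.

Section StringMeasure.
Variables (R : realType) (b : nat) (d : 'I_b) (k : nat).
Local Open Scope ereal_scope.

Definition string_measure (A : set (measurableTypeR R)) : \bar R :=
  \esum_(X in [set X : seq 'I_b | count_mem d X = k])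
    ((b%:R ^- size X)%:E * \d_(string_point R X : measurableTypeR R) A).

Let string_measure0 : string_measure set0 = 0.
Proof. by apply: esum1 => X _; rewrite measure0 mule0. Qed.

Let string_measure_ge0 A : 0 <= string_measure A.
Proof.
by apply: esum_ge0 => X _; rewrite mule_ge0// lee_fin invr_ge0 exprn_ge0.
Qed.

Let string_measure_sigma_additive : semi_sigma_additive string_measure.
Proof.
move=> F mF tF mUF.
have w0 (X : seq 'I_b) : 0 <= (b%:R ^- size X : R)%:E.
  by rewrite lee_fin invr_ge0 exprn_ge0.
have -> : string_measure (\bigcup_n F n) = \sum_(n <oo) string_measure (F n).
  pose a (n : nat) (X : seq 'I_b) : \bar R := (b%:R ^- size X)%:E *
    \d_(string_point R X : measurableTypeR R) (F n).
  have a0 n X : 0 <= a n X by rewrite mule_ge0.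
  rewrite nneseries_esumT//.
  rewrite (@esum_esum _ _ _ _ (fun=> [set X | count_mem d X = k]) a)//.
  rewrite (reindex_esum ([set X : seq 'I_b | count_mem d X = k] `*`` fun=> setT)
    _ (fun x => (x.2, x.1)))//; last first.
    split=> [[X n] []|[X n] [Y m] _ _ [-> ->]|[n X] []]//=.
    by move=> _ Xk; exists (X, n).
  rewrite -(@esum_esum _ _ _ _ (fun=> setT) (fun X n => a n X))//.
  apply: eq_esum => X _; rewrite -nneseries_esumT// nneseriesZl//.
  by congr (_ * _); apply/esym/cvg_lim => //; exact: measure_semi_sigma_additive.
by apply: is_cvg_nneseries => n _ _; exact: string_measure_ge0.
Qed.

HB.instance Definition _ := isMeasure.Build _ _ _ string_measure
  string_measure0 string_measure_ge0 string_measure_sigma_additive.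

End StringMeasure.
Arguments string_measure R {b} d k A.

Section StringMeasureFinite.
Variables (R : realType) (b : nat) (d : 'I_b).

Fixpoint short_strings (L : nat) : seq (seq 'I_b) :=
  if L is L'.+1 then
    [::] :: [seq c :: X | c <- enum 'I_b, X <- short_strings L']
  else [:: [::]].

Lemma mem_short_strings L X : (size X <= L)%N -> X \in short_strings L.
Proof.
elim: L X => [|L IH] [|c X]//= XL.
by rewrite inE; apply/allpairsP; exists (c, X); rewrite mem_enum IH.
Qed.

Lemma short_strings_mass (L k : nat) :
  \sum_(X <- short_strings L | count_mem d X == k) (b%:R ^- size X : R) <= b%:R.
Proof.
have b0 : (0 < b)%N by exact: leq_ltn_trans (ltn_ord d).
have bR0 : b%:R != 0 :> R by rewrite pnatr_eq0 -lt0n.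
have b1 : 1 <= b%:R :> R by rewrite ler1n.
elim: L k => [|L IH] k.
  rewrite /= big_mkcond big_seq1/=; case: ifP => _; rewrite ?expr0 ?invr1//.
rewrite /= big_mkcond big_cons/= big_allpairs_dep/=.
under eq_bigr do rewrite -big_mkcond/=.
pose S k := \sum_(X <- short_strings L | count_mem d X == k) (b%:R ^- size X : R).
have S0 j : 0 <= S j by apply: sumr_ge0 => X _; rewrite invr_ge0 exprn_ge0.
have step (c : 'I_b) : \sum_(X <- short_strings L | ((c == d) + count_mem d X)%N == k)
    (b%:R ^- (size X).+1 : R) <= if (c == d) && (k == 0%N) then 0 else 1.
  case: ifPn => [/andP[-> /eqP ->]|cdk].
    by rewrite big_pred0// => X; rewrite add1n.
  pose j := if c == d then k.-1 else k.
  have cE n : (((c == d) + n)%N == k) = (n == j).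
    by rewrite /j; move: cdk; case: (c == d) => //; case: (k).
  have -> : \sum_(X <- short_strings L | ((c == d) + count_mem d X)%N == k)
    (b%:R ^- (size X).+1 : R) = b%:R^-1 * S j.
    by rewrite /S mulr_sumr; apply: eq_big => [X|X _]; rewrite ?cE ?exprS ?invfM.
  by rewrite ler_pdivrMl ?ltr0n// mulr1; exact: IH.
have -> : \sum_(c <- enum 'I_b) \sum_(X <- short_strings L |
    ((c == d) + count_mem d X)%N == k) (b%:R ^- (size X).+1 : R) =
    \sum_(c : 'I_b) \sum_(X <- short_strings L |
    ((c == d) + count_mem d X)%N == k) (b%:R ^- (size X).+1 : R).
  by rewrite big_enum.
apply: (@le_trans _ _ ((if k == 0%N then 1 else 0) +
  \sum_(c : 'I_b) if (c == d) && (k == 0%N) then 0 else 1)).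
  case: k IH step => [|k] IH step /=; rewrite ?expr0 ?invr1 ?add0r.
    by rewrite lerD2l ler_sum.
  by rewrite ler_sum.
rewrite (bigD1 d)//= eqxx/= addrA.
have -> : (if k == 0%N then 1 else 0) + (if k == 0%N then 0 else 1) = 1 :> R.
  by case: k {IH step} => [|k]/=; rewrite ?addr0 ?add0r.
rewrite (eq_bigr (fun=> 1)) => [|c /negbTE ->//].
rewrite sumr_const cardC1 card_ord -[X in X + _]/(1%:R) -natrD ler_nat.
by rewrite add1n prednK.
Qed.

Let ler_sum_subseq (T : eqType) (P : pred T) (f : T -> R) (s t : seq T) :
  (forall x, 0 <= f x) -> uniq s -> {subset s <= t} -> all P s ->
  \sum_(x <- s) f x <= \sum_(x <- t | P x) f x.
Proof.
move=> f0; elim: s t => [|x s IH] t /=.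
  by move=> _ _ _; rewrite big_nil sumr_ge0.
move=> /andP[xs us] st /andP[Px Ps].
have xt : x \in t by apply: st; rewrite mem_head.
rewrite big_cons [leRHS](big_rem x)//= Px.
rewrite lerD2l; apply: IH => // y ys.
have : y \in t by apply: st; rewrite inE ys orbT.
rewrite (perm_mem (perm_to_rem xt)) inE.
by case/orP => // /eqP yx; rewrite -yx ys in xs.
Qed.

Lemma string_measure_setT k : (string_measure R d k setT <= b%:R%:E)%E.
Proof.
apply: ge_ereal_sup => _ [F [finF Fk] <-]; rewrite fsbig_finite//=.
under eq_bigr do rewrite diracT mule1.
rewrite sumEFin lee_fin.
pose L := (\max_(X <- finmap.enum_fset (fset_set F)) size X)%N.
apply: le_trans (short_strings_mass L k).
apply: ler_sum_subseq => [X||X XF|].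
- by rewrite invr_ge0 exprn_ge0.
- exact: finmap.fset_uniq.
- by apply: mem_short_strings; rewrite /L; exact: leq_bigmax_seq.
- by apply/allP => X; rewrite in_fset_set// inE => /Fk /eqP.
Qed.

Let string_measure_finite k : fin_num_fun (string_measure R d k).
Proof.
by apply: lty_fin_num_fun; exact: le_lt_trans (string_measure_setT k) (ltry _).
Qed.

HB.instance Definition _ k := @Measure_isFinite.Build _ _ _
  (string_measure R d k) (string_measure_finite k).

End StringMeasureFinite.

Section ChargeIntegral.
Context d (T : measurableType d) (R : realType).
Variable nu : {charge set T -> \bar R}.
Local Open Scope ereal_scope.

Let exP := cid (Hahn_decomposition nu).
Let exN := cid (projT2 exP).

(* The Jordan decomposition does not depend on the chosen Hahn
   decomposition. *)
Definition charge_integral (D : set T) (f : T -> \bar R) : \bar R :=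
  \int[jordan_pos (projT2 exN)]_(x in D) f x
  - \int[jordan_neg (projT2 exN)]_(x in D) f x.

End ChargeIntegral.

(* Main.v *)
Require Import Defs.
From HB Require Import structures.
From mathcomp Require Import all_boot all_order all_algebra.
From mathcomp Require Import all_classical all_reals all_analysis.
From mathcomp Require Import measurable_realfun.
From mathcomp Require Import ring lra.

Set Implicit Arguments.
Unset Strict Implicit.
Unset Printing Implicit Defensive.

Import Order.TTheory GRing.Theory Num.Theory.
Import numFieldNormedType.Exports.

Local Open Scope classical_set_scope.
Local Open Scope ring_scope.

(** Write [u_L] for the sum of [1/m] over [0 < m < b^L] with exactly [k]
occurrences of [d], so that [I(b,d,k)] is the limit of [u_L].

For a fixed [m], let the counted window of low digits grow from none to all
the digits of [m]: the indicator of [count = k] changes only when the new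
digit is [d], and it then changes by [count + 1 = k] minus [count = k]
([count_indicator_telescope]). Multiplying by [1/m], summing over [m < b^L]
and writing [m = N b^l + r], with [r < b^l] the window and [d] the last digit
of [N], turns [u_L] into a sum over windows of blocks of [1/(N b^l + r)] along
an arithmetic progression of [N]'s, plus a harmonic sum when [k = 0]
([kempner_partial_sum]). Since [psi(x + 1) = psi(x) + 1/x], each block is a
difference of two values of [psi] ([sum_inv_block]). The values at
[(d_1 + x)/b], where [x = r/b^l], build up the integrals with respect to
[mu_k] and [mu_(k-1)]. The values at the far end are [(L - l - 1) log b] up to
[b^-(L-l-1)] because [psi(x) - log x] tends to [0]; summed against the masses
of the levels of [mu_k], they tend to [b log b] ([sum_string_weightB],
[string_mass_cvg]), the error being a convolution of a summable sequence with
a geometric one ([geometric_convolution_cvg0]). For [k = 0] there is a further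
[- L log b], which the harmonic sum turns into [- psi(1)].

What is needed about [psi] is obtained without differentiating under the
integral sign. Integration by parts gives [Gamma(x + 1) = x Gamma(x)], and the
weighted arithmetic-geometric inequality under the integral gives
[Gamma(y + h) <= y^h Gamma(y)] for [0 <= h <= 1] ([Gamma_gautschi]). These two
facts squeeze the slopes of [log Gamma] at [x] between
[log(x + n) - sum_(i < n) 1/(x + i)] and itself plus [O(h)], in the limit of
large [n]; hence [log Gamma] is differentiable with that limit as derivative
([digamma_limE]), from which the functional equation, the monotonicity and the
bounds [log x - 1/x <= psi(x) <= log x] are read off. *)

(** * The Gamma integral *)

Section GammaFunction.
Variable R : realType.
Local Notation mu := (@lebesgue_measure R).
Implicit Types x y h t : R.

Definition gamma_integrand x t : R := t `^ (x - 1) * expR (- t).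

(** Euler's integral as an extended real, before its finiteness is known. *)
Definition eGamma x : \bar R :=
  (\int[mu]_(t in `]0%R, +oo[) (gamma_integrand x t)%:E)%E.

Lemma GammaE x : Gamma x = fine (eGamma x).
Proof. by []. Qed.

Lemma gamma_integrand_ge0 x t : 0 <= gamma_integrand x t.
Proof. by rewrite mulr_ge0 ?powR_ge0 ?expR_ge0. Qed.

Lemma measurable_gamma_integrand x (D : set R) :
  measurable_fun D (gamma_integrand x).
Proof.
apply: measurable_funTS; apply: measurable_funM.
  exact: measurable_powR.
by apply: measurableT_comp => //; exact: measurableT_comp.
Qed.

Lemma eGamma_cvg x :
  (\int[mu]_(t in `[n.+1%:R^-1%R, n.+1%:R%R]) (gamma_integrand x t)%:E)%E
    @[n --> \oo] --> eGamma x.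
Proof.
have -> : eGamma x = (\int[mu]_(t in \bigcup_n `[n.+1%:R^-1%R, n.+1%:R%R]%classic)
    (gamma_integrand x t)%:E)%E.
  congr (integral mu _ _); apply/seteqP; split => t /=.
    rewrite in_itv/= andbT => t0.
    exists (maxn (Num.truncn t) (Num.truncn t^-1)) => //=; rewrite in_itv/=.
    rewrite invf_ple ?posrE// (le_trans (ltW (truncnS_gt _)))/=; last first.
      by rewrite ler_nat ltnS leq_maxr.
    by rewrite (le_trans (ltW (truncnS_gt _)))// ler_nat ltnS leq_maxl.
  case=> n _; rewrite /= !in_itv/= andbT => /andP[+ _]; apply: lt_le_trans.
  by rewrite invr_gt0 ltr0n.
apply: ge0_nondecreasing_set_cvg_integral => //.
- move=> m n mn; apply/subsetPset => t /=; rewrite !in_itv/= => /andP[tm mt].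
  rewrite (le_trans _ tm) ?lef_pV2 ?posrE ?ltr0n ?ler_nat//=.
  by rewrite (le_trans mt)// ler_nat.
- by move=> n; apply/measurable_EFinP; exact: measurable_gamma_integrand.
- by move=> n t _; rewrite lee_fin gamma_integrand_ge0.
Qed.

Lemma within_continuous_gt0 (f : R -> R) (a c : R) : 0 < a ->
  (forall t, 0 < t -> {for t, continuous f}) -> {within `[a, c], continuous f}.
Proof.
move=> a0 cf; apply: continuous_in_subspaceT => t; rewrite inE/= in_itv/=.
by move=> /andP[at_ _]; apply: cf; exact: lt_le_trans at_.
Qed.

Lemma continuous_powR_gt0 x t : 0 < t -> {for t, continuous (@powR R ^~ x)}.
Proof.
move=> t0; apply/differentiable_continuous/derivable1_diffP.
by apply: ex_derive; exact: is_derive1_powR.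
Qed.

Lemma is_derive_NexpRN t : is_derive t 1 (fun s : R => - expR (- s)) (expR (- t)).
Proof.
by apply: is_derive_eq; rewrite /GRing.scale/= mulrN1 opprK.
Qed.

Lemma continuous_expRN t : {for t, continuous (fun s : R => expR (- s))}.
Proof.
by apply: continuous_comp; [exact: opp_continuous|exact: continuous_expR].
Qed.

Lemma derivable_gt0_LRcontinuous (F f : R -> R) (a c : R) : 0 < a -> a < c ->
  (forall t, 0 < t -> is_derive t 1 F (f t)) -> derivable_oo_LRcontinuous F a c.
Proof.
move=> a0 ac dF.
have cF t : 0 < t -> {for t, continuous F}.
  move=> t0; apply/differentiable_continuous/derivable1_diffP.
  by apply: ex_derive; exact: dF.
split.
- move=> t; rewrite in_itv/= => /andP[/(lt_trans a0) t0 _].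
  by apply: ex_derive; exact: dF.
- by apply: cvg_at_right_filter; exact: cF.
- by apply: cvg_at_left_filter; apply: cF; exact: lt_trans ac.
Qed.

(** Integration by parts on a compact interval away from [0]. *)
Lemma gamma_integral_by_parts x (a c : R) : 0 < a -> a < c ->
  (\int[mu]_(t in `[a, c]) (gamma_integrand (x + 1) t)%:E =
   (a `^ x * expR (- a) - c `^ x * expR (- c))%:E +
   x%:E * \int[mu]_(t in `[a, c]) (gamma_integrand x t)%:E)%E.
Proof.
move=> a0 ac.
pose F t := t `^ x; pose f t := x * t `^ (x - 1).
pose G t : R := - expR (- t); pose g t : R := expR (- t).
have cf : {within `[a, c], continuous f}.
  apply: within_continuous_gt0 => // t t0.
  by apply: continuousM; [exact: cst_continuous|exact: continuous_powR_gt0].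
have dF : derivable_oo_LRcontinuous F a c.
  by apply: derivable_gt0_LRcontinuous => // t t0; exact: is_derive1_powR.
have Ff : {in `]a, c[, F^`()%classic =1 f}.
  move=> t; rewrite in_itv/= => /andP[/(lt_trans a0) t0 _].
  by rewrite powR_derive1// in_itv/= t0.
have cg : {within `[a, c], continuous g}.
  by apply: within_continuous_gt0 => // t t0; exact: continuous_expRN.
have dG : derivable_oo_LRcontinuous G a c.
  by apply: derivable_gt0_LRcontinuous => // t t0; exact: is_derive_NexpRN.
have Gg : {in `]a, c[, G^`()%classic =1 g}.
  move=> t _; rewrite derive1E.
  by have [_ ->] := is_derive_NexpRN t.
have := integration_by_parts ac cf dF Ff cg dG Gg.
rewrite /F /G /f /g.
have -> : (\int[mu]_(t in `[a, c]) (gamma_integrand (x + 1) t)%:E =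
  \int[mu]_(t in `[a, c]) (t `^ x * expR (- t))%:E)%E.
  by apply: eq_integral => t _; rewrite /gamma_integrand addrK.
move=> ->; congr (_ + _)%E; first by congr EFin; rewrite !mulrN opprK addrC.
have -> : (\int[mu]_(t in `[a, c]) (x * t `^ (x - 1) * - expR (- t))%:E =
  \int[mu]_(t in `[a, c]) ((- x)%:E * (gamma_integrand x t)%:E))%E.
  apply: eq_integral => t _; rewrite /gamma_integrand -EFinM; congr EFin.
  by rewrite mulrN mulNr mulrA.
rewrite integralZl//; first by rewrite EFinN mulNe oppeK.
apply: continuous_compact_integrable; first exact: segment_compact.
apply: within_continuous_gt0 => // t t0; apply: continuousM.
  exact: continuous_powR_gt0.
exact: continuous_expRN.
Qed.

Lemma cvg_powR_expRN x :
  (n.+1%:R : R) `^ x * expR (- n.+1%:R) @[n --> \oo] --> 0.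
Proof.
pose N := (Num.truncn `|x|).+1.
have xN : x <= N%:R by rewrite (le_trans (ler_norm x))// ltW// truncnS_gt.
have N0 : 0 < (N.+1)`!%:R :> R by rewrite ltr0n fact_gt0.
apply: (@squeeze_cvgr _ _ _ _ (cst 0) (fun n => (N.+1)`!%:R * n.+1%:R^-1)).
- near=> n; rewrite mulr_ge0 ?powR_ge0 ?expR_ge0//=.
  rewrite expRN ler_pdivrMr ?expR_gt0//.
  apply: (@le_trans _ _ (n.+1%:R ^+ N)).
    rewrite -powR_mulrn ?ler0n//; apply: ler_powR => //.
    by rewrite ler1n.
  rewrite mulrAC ler_pdivlMr ?ltr0n// -exprSr -ler_pdivrMl// mulrC.
  rewrite (le_trans _ (expR_ge1Dxn N (ler0n R n.+1)))// lerDr.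
  exact: ler01.
- exact: cvg_cst.
- rewrite -[X in _ --> X](mulr0 (N.+1)`!%:R).
  by apply: cvgM; [exact: cvg_cst|exact: cvg_harmonic].
Unshelve. all: by end_near. Qed.

Lemma cvg_powR_harmonic x : 0 < x ->
  (n.+1%:R^-1 : R) `^ x * expR (- n.+1%:R^-1) @[n --> \oo] --> 0.
Proof.
move=> x0.
apply: (@squeeze_cvgr _ _ _ _ (cst 0) (fun n => (n.+1%:R^-1 : R) `^ x)).
- near=> n; rewrite mulr_ge0 ?powR_ge0 ?expR_ge0//=.
  by rewrite ler_piMr ?powR_ge0// -expR0 ler_expR oppr_le0 invr_ge0.
- exact: cvg_cst.
- have /cvg_at_rightP := powR_cvg0 x0; apply; split; last exact: cvg_harmonic.
  by move=> n; rewrite invr_gt0 ltr0n.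
Unshelve. all: by end_near. Qed.

Lemma eGammaS x : 0 < x -> eGamma (x + 1) = (x%:E * eGamma x)%E.
Proof.
move=> x0; rewrite -(cvg_lim _ (@eGamma_cvg (x + 1)))//; apply/cvg_lim => //.
pose u n : R := n.+1%:R^-1 `^ x * expR (- n.+1%:R^-1) -
  n.+1%:R `^ x * expR (- n.+1%:R).
have u0 : u n @[n --> \oo] --> 0.
  rewrite -[X in _ --> X](subr0 0); apply: cvgB; last exact: cvg_powR_expRN.
  exact: cvg_powR_harmonic.
rewrite -[X in _ --> X]add0e.
apply: (@cvg_trans _ (((u n)%:E + x%:E * \int[mu]_(t in
    `[n.+1%:R^-1%R, n.+1%:R%R]) (gamma_integrand x t)%:E)%E @[n --> \oo])).
  apply: near_eq_cvg; near=> n.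
  have n1 : 1 < n.+1%:R :> R.
    by rewrite ltr1n ltnS; near: n; exact: nbhs_infty_gt.
  have n0 : 0 < n.+1%:R^-1 :> R by rewrite invr_gt0 (lt_trans ltr01 n1).
  apply/esym/gamma_integral_by_parts; first exact: n0.
  by apply: (@lt_trans _ _ 1) => //; rewrite invf_lt1// (lt_trans ltr01 n1).
apply: cvgeD => //; first by apply: cvg_EFin u0; exact: nearW.
by apply: cvgeZl => //; exact: eGamma_cvg.
Unshelve. all: by end_near. Qed.

Lemma eGamma1 : eGamma 1 = 1%E.
Proof.
have -> : eGamma 1 = (\int[mu]_(t in `[0%R, +oo[) (expR (- t))%:E)%E.
  rewrite -integral_itv_obnd_cbnd; last first.
    by apply/measurable_EFinP; apply: measurable_funTS; exact: measurableT_comp.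
  apply: eq_integral => t _.
  by rewrite /gamma_integrand subrr powRr0 mul1r.
rewrite (@ge0_continuous_FTC2y _ _ (fun t => - expR (- t)) 0 0).
- by rewrite oppr0 expR0 EFinN oppeK add0e.
- by move=> t _; exact: expR_ge0.
- by apply: continuous_subspaceT => t; exact: continuous_expRN.
- rewrite -[X in _ --> X]oppr0; apply: cvgN; exact: cvgr_expR.
- by move=> t _; apply: ex_derive; exact: is_derive_NexpRN.
- apply: cvg_at_right_filter; apply: cvgN; exact: continuous_expRN.
- by move=> t _; rewrite derive1E; have [_ ->] := is_derive_NexpRN t.
Qed.

(** Weighted arithmetic-geometric mean inequality between [1] and [s]. *)
Lemma young_powR (s h : R) : 0 < s -> 0 <= h <= 1 -> s `^ h <= 1 - h + h * s.
Proof.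
move=> s0 /andP[h0 h1]; rewrite /powR gt_eqF//.
have [u su] : exists u, s = expR u by exists (ln s); rewrite lnK.
rewrite {}su expRK.
have -> : 1 - h + h * expR u =
    expR (h * u) * ((1 - h) * expR (- (h * u)) + h * expR ((1 - h) * u)).
  rewrite mulrDr mulrCA (mulrCA _ h) -!expRD subrr expR0 mulr1.
  by have -> : h * u + (1 - h) * u = u by ring.
rewrite -[leLHS]mulr1 ler_pM2l ?expR_gt0//.
apply: (@le_trans _ _ ((1 - h) * (1 - h * u) + h * (1 + (1 - h) * u))); first lra.
by apply: lerD; apply: ler_wpM2l; rewrite ?subr_ge0//; exact: expR_ge1Dx.
Qed.

Lemma eGamma_ge0 x : (0 <= eGamma x)%E.
Proof. by apply: integral_ge0 => t _; rewrite lee_fin gamma_integrand_ge0. Qed.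

(** Gautschi's inequality: [young_powR] at [s = t / y], integrated in [t]. *)
Lemma eGamma_gautschi y h : 0 < y -> 0 <= h <= 1 ->
  (eGamma (y + h) <= (y `^ h)%:E * eGamma y)%E.
Proof.
move=> y0 h01; have /andP[h0 h1] := h01.
have mg (z : R) : measurable_fun (`]0%R, +oo[ : set R) (EFin \o gamma_integrand z).
  by apply/measurable_EFinP; exact: measurable_gamma_integrand.
have ge (z t : R) : (`]0, +oo[%classic : set R) t ->
    (0 <= (EFin \o gamma_integrand z) t)%E.
  by move=> _; rewrite lee_fin gamma_integrand_ge0.
have -> : ((y `^ h)%:E * eGamma y = \int[mu]_(t in `]0%R, +oo[)
    (((y `^ h * (1 - h))%:E * (gamma_integrand y t)%:E) +
     ((y `^ h * (h / y))%:E * (gamma_integrand (y + 1) t)%:E)))%E.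
  have c1 : 0 <= y `^ h * (1 - h) by rewrite mulr_ge0 ?powR_ge0 ?subr_ge0.
  have c2 : 0 <= y `^ h * (h / y) by rewrite mulr_ge0 ?powR_ge0// divr_ge0// ltW.
  rewrite ge0_integralD//; last 4 first.
  - by move=> t t0; rewrite mule_ge0 ?lee_fin// gamma_integrand_ge0.
  - by apply: measurable_funeM; exact: mg.
  - by move=> t t0; rewrite mule_ge0 ?lee_fin// gamma_integrand_ge0.
  - by apply: measurable_funeM; exact: mg.
  rewrite ge0_integralZl//; last first.
  - exact: ge.
  - exact: mg.
  rewrite ge0_integralZl//; last first.
  - exact: ge.
  - exact: mg.
  rewrite -!/(eGamma _) eGammaS// muleA -EFinM -ge0_muleDl ?lee_fin//; last first.
    by rewrite mulr_ge0// ltW.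
  by rewrite -EFinD; congr (_%:E * _)%E; field; rewrite gt_eqF.
apply: ge0_le_integral => //.
- exact: ge.
- exact: mg.
- by apply: emeasurable_funD; apply: measurable_funeM; exact: mg.
- move=> t; rewrite /= in_itv/= andbT => t0.
  rewrite -!EFinM -EFinD lee_fin /gamma_integrand addrK.
  rewrite !mulrA -mulrDl ler_wpM2r ?expR_ge0//.
  have -> : y + h - 1 = (y - 1) + h by ring.
  rewrite powRD; last by rewrite (gt_eqF t0) implybT.
  have -> : t `^ y = t `^ (y - 1) * t.
    by rewrite mulrC mulr_powRB1// ltW.
  have -> : t `^ h = y `^ h * (t / y) `^ h.
    by rewrite -powRM ?divr_ge0 ?ltW// mulrC divfK// gt_eqF.
  have := @young_powR (t / y) h (divr_gt0 t0 y0) h01.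
  move=> /(ler_wpM2l (powR_ge0 t (y - 1)))/(ler_wpM2l (powR_ge0 y h)).
  rewrite mulrCA => /le_trans; apply; rewrite le_eqVlt; apply/orP; left.
  by apply/eqP; field; rewrite gt_eqF.
Qed.

(** On ]0, 1] finiteness and positivity are [eGamma_gautschi] compared with
[eGamma 1 = 1]; the functional equation propagates them upwards. *)
Lemma eGamma_fin_gt0 x : 0 < x -> (0 < eGamma x < +oo)%E.
Proof.
move=> x0.
have base y : 0 < y <= 1 -> (0 < eGamma y < +oo)%E.
  move=> /andP[y0 y1].
  have fy : (eGamma y < +oo)%E.
    have : (eGamma (y + 1) < +oo)%E.
      rewrite addrC (le_lt_trans (eGamma_gautschi _ _)) ?ltr01 ?(ltW y0)//.
      by rewrite eGamma1 mule1 ltry.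
    rewrite eGammaS//; have := eGamma_ge0 y.
    by case: (eGamma y) => [r _ _|_|//]; rewrite ?ltry// gt0_muley ?lte_fin.
  rewrite fy andbT lt_neqAle eGamma_ge0 andbT; apply/eqP => y00.
  have := @eGamma_gautschi y (1 - y) y0.
  rewrite subr_ge0 y1 gerBl (ltW y0) => /(_ isT).
  by rewrite addrC subrK eGamma1 -y00 mule0 lee_fin ler10.
have [n xn] : exists n : nat, x <= n.+1%:R.
  by exists (Num.truncn x); rewrite ltW// truncnS_gt.
elim: n x x0 xn => [|n IH] x x0 xn; first by apply: base; rewrite x0.
have [x1|x1] := leP x 1; first by apply: base; rewrite x0.
have x10 : 0 < x - 1 by rewrite subr_gt0.
have := IH (x - 1) x10; rewrite lerBlDr -natr1 in xn *.
move=> /(_ xn)/andP[g0 goo]; rewrite -(subrK 1 x) eGammaS//.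
by rewrite mule_gt0//= lte_mul_pinfty// lee_fin ltW.
Qed.

Lemma Gamma_gt0 x : 0 < x -> 0 < Gamma x.
Proof. by move=> /eGamma_fin_gt0 ?; rewrite GammaE fine_gt0. Qed.

Lemma EFin_Gamma x : 0 < x -> (Gamma x)%:E = eGamma x.
Proof.
move=> /eGamma_fin_gt0/andP[? ?].
by rewrite GammaE fineK// ge0_fin_numE ?eGamma_ge0.
Qed.

Lemma GammaS x : 0 < x -> Gamma (x + 1) = x * Gamma x.
Proof.
move=> x0; apply: EFin_inj.
by rewrite EFinM !EFin_Gamma ?eGammaS// addr_gt0.
Qed.

Lemma Gamma_gautschi y h : 0 < y -> 0 <= h <= 1 ->
  Gamma (y + h) <= y `^ h * Gamma y.
Proof.
move=> y0 /[dup] /andP[h0 _] h01.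
by rewrite -lee_fin EFinM !EFin_Gamma ?eGamma_gautschi// ltr_wpDr.
Qed.

End GammaFunction.

(** * The digamma function on the positive half-line *)

Section Digamma.
Variable R : realType.
Implicit Types x y h : R.

Lemma ln_diff_le (a h : R) : 0 < a -> 0 <= h -> ln (a + h) - ln a <= h / a.
Proof.
move=> a0 h0; have ah0 : 0 < a + h by rewrite ltr_wpDr.
rewrite -ln_div ?posrE//.
have -> : (a + h) / a = 1 + h / a by field; rewrite gt_eqF.
by apply: le_ln1Dx; rewrite (lt_le_trans _ (divr_ge0 h0 (ltW a0))) ?ltrN10.
Qed.

Lemma ln_diff_ge (a h : R) : 0 < a -> 0 <= h -> h / (a + h) <= ln (a + h) - ln a.
Proof.
move=> a0 h0; have ah0 : 0 < a + h by rewrite ltr_wpDr.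
rewrite -lerN2 opprB -ln_div ?posrE//.
have -> : a / (a + h) = 1 + - (h / (a + h)) by field; rewrite gt_eqF.
apply: le_ln1Dx; rewrite ltrN2 ltr_pdivrMr// mul1r ltrDr//.
Qed.

Definition lnGamma x : R := ln (Gamma x).

(* Linear arithmetic on the goal, transcendental subterms being atoms. *)
Ltac lra_atoms :=
  repeat match goal with
  | |- context [bigop ?z ?r ?F] => generalize (bigop z r F)
  | |- context [lnGamma ?a] => generalize (lnGamma a)
  | |- context [ln ?a] => generalize (ln a)
  end; intros; lra.

Lemma lnGammaS x : 0 < x -> lnGamma (x + 1) = ln x + lnGamma x.
Proof. by move=> x0; rewrite /lnGamma GammaS// lnM ?posrE ?Gamma_gt0. Qed.

Lemma lnGammaDn x n : 0 < x ->
  lnGamma (x + n%:R) = lnGamma x + \sum_(i < n) ln (x + i%:R).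
Proof.
move=> x0; elim: n => [|n IH]; first by rewrite big_ord0 !addr0.
rewrite big_ord_recr/= addrA -IH -natr1 addrA lnGammaS ?ltr_wpDr//.
exact: addrC.
Qed.

Lemma lnGamma_diff_le x h : 0 < x -> 0 <= h <= 1 ->
  lnGamma (x + h) - lnGamma x <= h * ln x.
Proof.
move=> x0 /[dup]/andP[h0 h1] h01; have xh0 : 0 < x + h by rewrite ltr_wpDr.
rewrite -ln_div ?posrE ?Gamma_gt0// -ln_powR.
rewrite ler_ln ?posrE ?divr_gt0 ?powR_gt0 ?Gamma_gt0//.
by rewrite ler_pdivrMr ?Gamma_gt0// Gamma_gautschi.
Qed.

Lemma lnGamma_diff_ge x h : 0 < x -> 0 <= h <= 1 ->
  h * (ln x - x^-1) <= lnGamma (x + h) - lnGamma x.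
Proof.
move=> x0 /andP[h0 h1]; have xh0 : 0 < x + h by rewrite ltr_wpDr.
have := @lnGamma_diff_le (x + h) (1 - h) xh0.
rewrite subr_ge0 h1 gerBl h0 => /(_ isT).
have -> : x + h + (1 - h) = x + 1 by ring.
rewrite lnGammaS// => H.
have l1 := ln_diff_le x0 h0.
have l2 : ln x <= ln (x + h) by rewrite ler_ln ?posrE// lerDl.
have := ler_wpM2l h0 l2.
by move: H l1; clear; lra_atoms.
Qed.

(** For [x > 0], a sequence decreasing to [psi(x)]. *)
Definition digamma_seq x (n : nat) : R :=
  ln (x + n%:R) - \sum_(i < n) (x + i%:R)^-1.

(** Bounds the sum over [i] of [1/(x + i)^2], hence the error, per unit of [h],
in the slope of [lnGamma] between [x] and [x + h]. *)
Definition slope_err x : R := (1 + x^-1) / x.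

Lemma slope_err_ge0 x : 0 < x -> 0 <= slope_err x.
Proof. by move=> x0; rewrite /slope_err divr_ge0 ?addr_ge0 ?invr_ge0 ?ltW. Qed.

Lemma addr_nat_gt0 x n : 0 < x -> 0 < x + n%:R.
Proof. by move=> x0; rewrite ltr_wpDr. Qed.

Lemma sum_inv_diff_le x y n : 0 < x -> x <= y ->
  \sum_(i < n) ((x + i%:R)^-1 - (y + i%:R)^-1) <= (y - x) * slope_err x.
Proof.
move=> x0 xy; have y0 := lt_le_trans x0 xy.
(* 1/(x + n)^2 <= (1 + 1/x) (1/(x + n) - 1/(x + n + 1)) telescopes *)
apply: (@le_trans _ _ ((y - x) * (slope_err x - (1 + x^-1) / (x + n%:R)))); last first.
  rewrite ler_wpM2l ?subr_ge0// gerBl divr_ge0//.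
    by rewrite addr_ge0// invr_ge0 ltW.
  exact/ltW/addr_nat_gt0.
elim: n => [|n IH]; first by rewrite big_ord0 addr0 subrr mulr0.
rewrite big_ord_recr/=.
have xn0 := addr_nat_gt0 n x0; have yn0 := addr_nat_gt0 n y0.
have xn1 := addr_nat_gt0 n.+1 x0.
have -> : (y - x) * (slope_err x - (1 + x^-1) / (x + n.+1%:R)) =
  (y - x) * (slope_err x - (1 + x^-1) / (x + n%:R)) +
  (y - x) * ((1 + x^-1) / ((x + n%:R) * (x + n.+1%:R))).
  rewrite -natr1; field; rewrite !gt_eqF//.
  by rewrite natr1.
apply: lerD => //.
have -> : (x + n%:R)^-1 - (y + n%:R)^-1 = (y - x) * ((x + n%:R)^-1 * (y + n%:R)^-1).
  by field; rewrite !gt_eqF.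
rewrite ler_wpM2l ?subr_ge0// invfM mulrCA ler_wpM2l ?invr_ge0 ?(ltW xn0)//.
apply: (@le_trans _ _ (x + n%:R)^-1).
  by rewrite lef_pV2 ?posrE// lerD2r.
rewrite ler_pdivlMr// -natr1 addrA mulrDr mulVf ?gt_eqF// mulr1 lerD2l.
by rewrite lef_pV2 ?posrE// lerDl.
Qed.

(** The slope of [lnGamma] at [x] is the slope at [x + n] corrected by a sum of
slopes of [ln]. *)
Lemma lnGamma_slope_ge x h n : 0 < x -> 0 <= h <= 1 ->
  h * (digamma_seq x n - (x + n%:R)^-1) <= lnGamma (x + h) - lnGamma x.
Proof.
move=> x0 /[dup]/andP[h0 h1] h01; have xh0 : 0 < x + h by rewrite ltr_wpDr.
have := @lnGamma_diff_ge (x + n%:R) h (addr_nat_gt0 n x0) h01.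
have -> : x + n%:R + h = x + h + n%:R by rewrite addrAC.
rewrite !lnGammaDn// /digamma_seq.
have : \sum_(i < n) ln (x + h + i%:R) - \sum_(i < n) ln (x + i%:R) <=
    h * \sum_(i < n) (x + i%:R)^-1.
  rewrite -sumrB mulr_sumr; apply: ler_sum => i _.
  by rewrite addrAC ln_diff_le// addr_nat_gt0.
by clear; lra_atoms.
Qed.

Lemma lnGamma_slope_le x h n : 0 < x -> 0 <= h <= 1 ->
  lnGamma (x + h) - lnGamma x <= h * (digamma_seq x n + h * slope_err x).
Proof.
move=> x0 /[dup]/andP[h0 h1] h01; have xh0 : 0 < x + h by rewrite ltr_wpDr.
have := @lnGamma_diff_le (x + n%:R) h (addr_nat_gt0 n x0) h01.
have -> : x + n%:R + h = x + h + n%:R by rewrite addrAC.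
rewrite !lnGammaDn// /digamma_seq.
have H1 : h * \sum_(i < n) (x + h + i%:R)^-1 <=
   \sum_(i < n) ln (x + h + i%:R) - \sum_(i < n) ln (x + i%:R).
  rewrite -sumrB mulr_sumr; apply: ler_sum => i _.
  by rewrite [x + h + _]addrAC ln_diff_ge// addr_nat_gt0.
have H2 : \sum_(i < n) (x + i%:R)^-1 - \sum_(i < n) (x + h + i%:R)^-1 <=
    h * slope_err x.
  have {2}-> : h = x + h - x by rewrite addrC addKr.
  by rewrite -sumrB sum_inv_diff_le// lerDl.
by move: H1 (ler_wpM2l h0 H2); clear; lra_atoms.
Qed.

Lemma nonincreasing_digamma_seq x : 0 < x -> nonincreasing_seq (digamma_seq x).
Proof.
move=> x0; apply/nonincreasing_seqP => n; rewrite /digamma_seq.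
have -> : \sum_(i < n.+1) (x + i%:R)^-1 =
    \sum_(i < n) (x + i%:R)^-1 + (x + n%:R)^-1 by rewrite big_ord_recr.
have : ln (x + n.+1%:R) - ln (x + n%:R) <= (x + n%:R)^-1.
  by rewrite -natr1 addrA -[leRHS]mul1r ln_diff_le// addr_nat_gt0.
by clear; move: (_^-1); lra_atoms.
Qed.

(** The limit shown below to be the digamma function. *)
Definition digamma_lim x : R := limn (digamma_seq x).

Lemma is_cvg_digamma_seq x : 0 < x -> cvgn (digamma_seq x).
Proof.
move=> x0; apply: nonincreasing_is_cvgn; first exact: nonincreasing_digamma_seq.
exists (lnGamma (x + 1) - lnGamma x - slope_err x) => _ [n _ <-].
have := @lnGamma_slope_le x 1 n x0; rewrite ler01 lexx => /(_ isT).
by rewrite !mul1r; clear; lra_atoms.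
Qed.

Lemma digamma_lim_le_seq x n : 0 < x -> digamma_lim x <= digamma_seq x n.
Proof.
move=> x0; apply: nonincreasing_cvgn_ge; first exact: nonincreasing_digamma_seq.
exact: is_cvg_digamma_seq.
Qed.

Lemma cvg_inv_addn x : (x + n%:R)^-1 @[n --> \oo] --> 0.
Proof.
apply/cvgrPdist_le => e e0; near=> n.
have en : e^-1 + `|x| <= n%:R by near: n; exact: nbhs_infty_ger.
have xn : e^-1 <= x + n%:R.
  by rewrite -lerBlDl (le_trans _ en)// lerD2l -normrN ler_norm.
have xn0 : 0 < x + n%:R by rewrite (lt_le_trans _ xn)// invr_gt0.
by rewrite sub0r normrN gtr0_norm ?invr_gt0// invf_ple ?posrE.
Unshelve. all: by end_near. Qed.

Lemma lnGamma_lim_slope_ge x h : 0 < x -> 0 <= h <= 1 ->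
  h * digamma_lim x <= lnGamma (x + h) - lnGamma x.
Proof.
move=> x0 h01.
have H : h * (digamma_seq x n - (x + n%:R)^-1) @[n --> \oo] --> h * digamma_lim x.
  apply: cvgMr; rewrite -[digamma_lim x]subr0.
  apply: cvgB; last exact: cvg_inv_addn.
  exact: is_cvg_digamma_seq.
rewrite -(cvg_lim _ H)//; apply: limr_le.
  by apply/cvg_ex; eexists; exact: H.
by near=> n; exact: lnGamma_slope_ge.
Unshelve. all: by end_near. Qed.

Lemma lnGamma_lim_slope_le x h : 0 < x -> 0 <= h <= 1 ->
  lnGamma (x + h) - lnGamma x <= h * (digamma_lim x + h * slope_err x).
Proof.
move=> x0 h01.
have H : h * (digamma_seq x n + h * slope_err x) @[n --> \oo] -->
    h * (digamma_lim x + h * slope_err x).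
  apply: cvgMr; apply: cvgD; last exact: cvg_cst.
  exact: is_cvg_digamma_seq.
rewrite -(cvg_lim _ H)//; apply: limr_ge.
  by apply/cvg_ex; eexists; exact: H.
by near=> n; exact: lnGamma_slope_le.
Unshelve. all: by end_near. Qed.

Lemma digamma_lim_le_ln x : 0 < x -> digamma_lim x <= ln x.
Proof.
by move=> /(digamma_lim_le_seq 0); rewrite /digamma_seq big_ord0 subr0 addr0.
Qed.

Lemma digamma_lim_ge_ln x : 0 < x -> ln x - x^-1 <= digamma_lim x.
Proof.
move=> x0; apply/ler_addgt0Pr => e e0.
pose h := Num.min 1 (e / (slope_err x + 1)).
have K1 : 0 < slope_err x + 1 by rewrite ltr_wpDl ?slope_err_ge0.
have h0 : 0 < h by rewrite lt_min ltr01 divr_gt0.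
have h01 : 0 <= h <= 1 by rewrite ltW//= ge_min lexx.
have /le_trans/(_ (lnGamma_lim_slope_le x0 h01)) := lnGamma_diff_ge x0 h01.
rewrite ler_pM2l// => /le_trans; apply; rewrite lerD2l.
apply: (@le_trans _ _ (h * (slope_err x + 1))).
  by rewrite ler_wpM2l ?lerDl// ltW.
by rewrite -ler_pdivlMr// ge_min lexx orbT.
Qed.

Lemma digamma_lim_le x y : 0 < x -> x <= y -> digamma_lim x <= digamma_lim y.
Proof.
move=> x0 xy; have y0 := lt_le_trans x0 xy.
apply: ler_lim; [exact: is_cvg_digamma_seq..|near=> n].
rewrite /digamma_seq lerB//.
  by rewrite ler_ln ?posrE ?addr_nat_gt0// lerD2r.
by apply: ler_sum => i _; rewrite lef_pV2 ?posrE ?addr_nat_gt0// lerD2r.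
Unshelve. all: by end_near. Qed.

Lemma digamma_lim_lipschitz x y : 0 < x -> x <= y ->
  digamma_lim y <= digamma_lim x + (y - x) * (x^-1 + slope_err x).
Proof.
move=> x0 xy; have y0 := lt_le_trans x0 xy.
have H : digamma_seq x n + (y - x) * (x^-1 + slope_err x) @[n --> \oo] -->
    digamma_lim x + (y - x) * (x^-1 + slope_err x).
  apply: cvgD; last exact: cvg_cst.
  exact: is_cvg_digamma_seq.
rewrite -(cvg_lim _ H)//; apply: ler_lim; first exact: is_cvg_digamma_seq.
  by apply/cvg_ex; eexists; exact: H.
near=> n; rewrite /digamma_seq.
have : \sum_(i < n) (x + i%:R)^-1 - \sum_(i < n) (y + i%:R)^-1 <=
    (y - x) * slope_err x.
  by rewrite -sumrB sum_inv_diff_le.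
have := @ln_diff_le (x + n%:R) (y - x) (addr_nat_gt0 n x0).
have -> : x + n%:R + (y - x) = y + n%:R by ring.
rewrite subr_ge0 => /(_ xy).
have : (y - x) / (x + n%:R) <= (y - x) / x.
  rewrite ler_wpM2l ?subr_ge0// lef_pV2 ?posrE ?addr_nat_gt0//.
  by rewrite lerDl.
by clear; lra_atoms.
Unshelve. all: by end_near. Qed.

Lemma digamma_limS x : 0 < x -> digamma_lim (x + 1) = digamma_lim x + x^-1.
Proof.
move=> x0.
have H : digamma_seq x n.+1 + x^-1 @[n --> \oo] --> digamma_lim x + x^-1.
  apply: cvgD; last exact: cvg_cst.
  by rewrite (cvg_shiftS (digamma_seq x)); exact: is_cvg_digamma_seq.
rewrite -(cvg_lim _ H)// /digamma_lim; congr (limn _); apply/funext => n.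
rewrite /digamma_seq big_ord_recl/= addr0 opprD addrA addrAC addrNK; congr (_ - _).
  by rewrite -nat1r addrA.
by apply: eq_bigr => i _; rewrite /bump add1n -nat1r addrA.
Qed.

(** For an increment [h = - k < 0] the slope bounds are used at [x - k], and
[digamma_lim] is compared at [x - k] and [x]. *)
Lemma is_derive_lnGamma x : 0 < x -> is_derive x 1 lnGamma (digamma_lim x).
Proof.
move=> x0; have x20 : 0 < x / 2 by rewrite divr_gt0.
(* a common bound for the second-order error terms on [x / 2, +oo[ *)
have [M M0 KM] : exists2 M : R, 0 < M &
    forall z, x / 2 <= z -> slope_err z <= M /\ z^-1 + slope_err z <= M.
  exists ((x / 2)^-1 + slope_err (x / 2)).
    by rewrite ltr_wpDr ?slope_err_ge0// invr_gt0.
  move=> z xz; have z0 := lt_le_trans x20 xz.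
  have h1 : z^-1 <= (x / 2)^-1 by rewrite lef_pV2.
  have h2 : slope_err z <= slope_err (x / 2).
    by rewrite /slope_err ler_pM ?addr_ge0 ?invr_ge0 ?lerD2l ?(ltW z0).
  split; last exact: lerD.
  by rewrite (le_trans h2)// lerDr invr_ge0 ltW.
have H : h^-1 *: (lnGamma (h *: 1 + x) - lnGamma x) @[h --> 0^'] --> digamma_lim x.
  apply/cvgrPdist_le => e e0; near=> h.
  have h0 : h != 0 by near: h; exact: nbhs_dnbhs_neq.
  have h1 : `|h| < Num.min 1 (Num.min (x / 2) (e / M)).
    near: h; apply: dnbhs0_lt.
    by rewrite !lt_min ltr01 x20 divr_gt0.
  move: h1; rewrite !lt_min (ltr_pdivlMr _ _ M0) => /and3P[h1 hx he].
  rewrite /GRing.scale/= mulr1 [h + x]addrC.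
  suff : `|h * digamma_lim x - (lnGamma (x + h) - lnGamma x)| <= `|h| * (`|h| * M).
    move=> H; rewrite -(ler_pM2l (_ : 0 < `|h|)) ?normr_gt0//.
    rewrite -normrM mulrBr mulVKf//.
    by apply: (le_trans H); rewrite ler_wpM2l// ltW.
  have [h_gt0|h_lt0|/eqP] := ltgtP 0 h; last by rewrite eq_sym (negbTE h0).
    rewrite gtr0_norm// in h1 hx he *.
    have h01 : 0 <= h <= 1 by rewrite !ltW.
    rewrite distrC ger0_norm ?subr_ge0 ?lnGamma_lim_slope_ge//.
    rewrite lerBlDl (le_trans (lnGamma_lim_slope_le x0 h01))// mulrDr lerD2l.
    rewrite ler_wpM2l ?(ltW h_gt0)// ler_wpM2l ?(ltW h_gt0)//.
    by apply: (KM x _).1; rewrite ler_pdivrMr// ler_pMr// ler1n.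
  have [k k0 hk] : exists2 k : R, 0 < k & h = - k.
    by exists (- h); rewrite ?oppr_gt0 ?opprK.
  move: h1 hx he; rewrite hk normrN gtr0_norm// => h1 hx he.
  have k01 : 0 <= k <= 1 by rewrite !ltW.
  pose z := x - k; have xz : x = z + k by rewrite /z subrK.
  have z2 : x / 2 <= z by rewrite /z lerBrDr [leRHS]splitr lerD2l ltW.
  have z0 := lt_le_trans x20 z2.
  have zx : z <= x by rewrite xz lerDl ltW.
  have S1 := lnGamma_lim_slope_ge z0 k01; have S2 := lnGamma_lim_slope_le z0 k01.
  have S3 := digamma_lim_le z0 zx; have S4 := digamma_lim_lipschitz z0 zx.
  have [K1 K2] := KM z z2.
  rewrite -/z; rewrite -xz in S1 S2.
  have xzk : x - z = k by rewrite xz addrC addKr.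
  rewrite xzk in S4.
  have S4' : digamma_lim x <= digamma_lim z + k * M.
    by rewrite (le_trans S4)// lerD2l ler_wpM2l// ltW.
  have S2' : lnGamma x - lnGamma z <= k * (digamma_lim z + k * M).
    rewrite (le_trans S2)// ler_wpM2l ?(ltW k0)// lerD2l ler_wpM2l ?(ltW k0)//.
  rewrite ler_norml; apply/andP; split.
    have := ler_wpM2l (ltW k0) S4'.
    by move: S1; clear; move: (digamma_lim x) (digamma_lim z); lra_atoms.
  have := ler_wpM2l (ltW k0) S3.
  by move: S2'; clear; move: (digamma_lim x) (digamma_lim z); lra_atoms.
split.
  by apply/cvg_ex; eexists; exact: H.
exact: cvg_lim H.
Unshelve. all: by end_near. Qed.

(** The limit [digamma_lim] is the logarithmic derivative of [Gamma]. *)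
Lemma digamma_limE x : 0 < x -> digamma x = digamma_lim x.
Proof.
move=> x0; have dG : is_derive x 1 (@Gamma R) (Gamma x * digamma_lim x).
  apply: (@near_eq_is_derive _ _ _ (expR \o lnGamma)).
    near=> y; rewrite /= lnK// posrE; apply: Gamma_gt0; near: y.
    exact: lt_nbhsr.
  have := @is_derive1_comp _ expR lnGamma x _ _
    (is_derive_expR _) (is_derive_lnGamma x0).
  by rewrite [expR _]lnK// posrE Gamma_gt0.
rewrite /digamma derive1E; have [_ ->] := dG.
by rewrite mulrC mulKf// gt_eqF// Gamma_gt0.
Unshelve. all: by end_near. Qed.

Lemma digamma_le_ln x : 0 < x -> digamma x <= ln x.
Proof. by move=> x0; rewrite digamma_limE ?digamma_lim_le_ln. Qed.

Lemma digamma_ge_ln x : 0 < x -> ln x - x^-1 <= digamma x.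
Proof. by move=> x0; rewrite digamma_limE ?digamma_lim_ge_ln. Qed.

Lemma digammaS x : 0 < x -> digamma (x + 1) = digamma x + x^-1.
Proof. by move=> x0; rewrite !digamma_limE ?digamma_limS ?addr_gt0. Qed.

Lemma digamma_le x y : 0 < x -> x <= y -> digamma x <= digamma y.
Proof.
by move=> x0 xy; rewrite !digamma_limE ?digamma_lim_le// (lt_le_trans x0).
Qed.

Lemma digammaDn x n : 0 < x ->
  digamma (x + n%:R) = digamma x + \sum_(i < n) (x + i%:R)^-1.
Proof.
move=> x0; elim: n => [|n IH]; first by rewrite big_ord0 !addr0.
by rewrite big_ord_recr/= addrA -IH -natr1 addrA digammaS ?addr_nat_gt0.
Qed.

End Digamma.

(** * Counting digits *)

Section DigitCount.
Variables (R : realType) (b d : nat).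
Hypothesis hb : (1 < b)%N.

(** The digit of [m] in base [b] at position [l], zero beyond the leading one. *)
Definition digit (l m : nat) : nat := ((m %/ b ^ l) %% b)%N.

(** Occurrences of [d] among the [l] low digits of [m], leading zeros included. *)
Definition digit_count (l m : nat) : nat :=
  (\sum_(i < l) (digit i m == d))%N.

Lemma digit_count0 m : digit_count 0 m = 0%N.
Proof. exact: big_ord0. Qed.

Lemma digit_countSr l m :
  digit_count l.+1 m = (digit_count l m + (digit l m == d))%N.
Proof. exact: big_ord_recr. Qed.

Lemma digit_countS l m :
  digit_count l.+1 m = ((m %% b == d) + digit_count l (m %/ b))%N.
Proof.
rewrite /digit_count big_ord_recl; congr addn.
  by rewrite /digit expn0 divn1.
by apply: eq_bigr => i _; rewrite /digit lift0 expnS divnMA.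
Qed.

Lemma count_digits m :
  count_mem d (digits b m) = digit_count (trunc_log b m).+1 m.
Proof.
rewrite /digits count_map -sum1_count big_mkcond /digit_count.
rewrite -(big_mkord xpredT (fun i => nat_of_bool (digit i m == d))).
by rewrite /index_iota subn0; apply: eq_bigr => i _ /=; case: eqP.
Qed.

Lemma digit_count_low l N r :
  digit_count l (N * b ^ l + r) = digit_count l r.
Proof.
apply: eq_bigr => i _; congr (nat_of_bool (_ == _)).
have b0 : (0 < b ^ i)%N by rewrite expn_gt0 ltnW.
have -> : (N * b ^ l = N * b ^ (l - i.+1) * b * b ^ i)%N.
  by rewrite -!mulnA -expnS -expnD subnK.
by rewrite /digit divnMDl// modnMDl.
Qed.

Lemma sum_nat_block (F : nat -> R) (K B : nat) :
  \sum_(0 <= m < K * B) F m =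
  \sum_(0 <= N < K) \sum_(0 <= r < B) F (N * B + r)%N.
Proof.
elim: K => [|K IH]; first by rewrite mul0n !big_geq.
rewrite big_nat_recr//= -IH mulSn addnC.
rewrite (@big_cat_nat _ _ _ (K * B)%N)//= ?leq_addr//.
congr (_ + _); rewrite -{1}[(K * B)%N]add0n big_addn addKn.
by apply: eq_bigr => r _; rewrite addnC.
Qed.

(** Variation of the indicator of [count = k] when one more [d] is read after
the [l] low digits of [r]. *)
Definition count_jump (k l r : nat) : R :=
  ((digit_count l r).+1 == k)%:R - (digit_count l r == k)%:R.

Lemma count_indicator_telescope (k L m : nat) :
  ((digit_count L m == k)%:R : R) = (k == 0%N)%:R +
  \sum_(0 <= l < L) (digit l m == d)%:R * count_jump k l m.
Proof.
elim: L => [|L IH]; first by rewrite big_geq// addr0 digit_count0 eq_sym.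
rewrite big_nat_recr//= addrA -IH digit_countSr /count_jump.
by case: (digit L m == d); rewrite ?addn1 ?addn0 ?mul1r ?mul0r ?addr0// addrC subrK.
Qed.

Lemma leq_expn_trunc_log l m : (0 < m)%N ->
  (l < (trunc_log b m).+1)%N = (b ^ l <= m)%N.
Proof.
move=> m0; rewrite ltnS; apply/idP/idP => [lt|/(trunc_log_max hb)//].
by rewrite (leq_trans _ (trunc_logP hb m0))// leq_pexp2l// ltnW.
Qed.

Lemma count_digits_indicator (k L m : nat) : (0 < m < b ^ L)%N ->
  ((count_mem d (digits b m) == k)%:R : R) = (k == 0%N)%:R +
  \sum_(0 <= l < L | (b ^ l <= m)%N)
    (digit l m == d)%:R * count_jump k l m.
Proof.
move=> /andP[m0 mL]; rewrite count_digits count_indicator_telescope; congr +%R.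
have tL : ((trunc_log b m).+1 <= L)%N.
  by rewrite -(ltn_exp2l _ _ hb) (leq_ltn_trans _ mL)// trunc_logP.
rewrite (big_nat_widen _ _ _ _ _ tL); apply: eq_bigl => l /=.
exact: leq_expn_trunc_log.
Qed.

(** The least positive integer whose last digit is [d]. *)
Definition least_pos_rep : nat := if (0 < d)%N then d else b.
(** Number of positive integers below [b^(j+1)] with last digit [d]. *)
Definition block_len (j : nat) : nat := (if 0 < d then b ^ j else (b ^ j).-1)%N.

Lemma sum_last_digit (F : nat -> R) (j : nat) :
  \sum_(0 <= n < b ^ j | (0 < n * b + d)%N) F (n * b + d)%N =
  \sum_(0 <= n < block_len j) F (n * b + least_pos_rep)%N.
Proof.
rewrite /block_len /least_pos_rep; case: ltnP => [d0|].
  by apply: eq_bigl => n; rewrite addn_gt0 d0 orbT.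
rewrite leqn0 => /eqP ->.
have : (0 < b ^ j)%N by rewrite expn_gt0 ltnW.
case: (b ^ j)%N => // K _; rewrite big_mkcond big_nat_recl//= ?mul0n add0r.
by apply: eq_bigr => n _; rewrite addn0 muln_gt0/= (ltnW hb) mulSn addnC.
Qed.

(** The term at [m = 0] vanishes, since [0^-1 = 0]. *)
Lemma kempner_partial_sum (k L : nat) : (d < b)%N ->
  \sum_(0 <= m < b ^ L | count_mem d (digits b m) == k) m%:R^-1 =
  (k == 0%N)%:R * \sum_(0 <= m < b ^ L) m%:R^-1 +
  \sum_(0 <= l < L) \sum_(0 <= r < b ^ l) count_jump k l r *
     \sum_(0 <= n < block_len (L - l.+1))
        ((n * b + least_pos_rep) * b ^ l + r)%:R^-1 :> R.
Proof.
move=> db.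
transitivity (\sum_(0 <= m < b ^ L) m%:R^-1 * ((k == 0%N)%:R +
  \sum_(0 <= l < L | (b ^ l <= m)%N)
    (digit l m == d)%:R * count_jump k l m)).
  rewrite big_mkcond/=; apply: eq_big_nat => m /andP[_ mL].
  have [->|m0] := posnP m; first by rewrite invr0 mul0r; case: ifP.
  rewrite -count_digits_indicator ?m0//.
  by case: eqP => _; rewrite ?mulr1 ?mulr0.
(* exchange the sums over m and l, then split m into (n b + c) b^l + r *)
under eq_bigr do rewrite mulrDr mulrC mulr_sumr.
rewrite big_split/= -mulr_sumr; congr +%R.
under eq_bigr do rewrite big_mkcond/=.
rewrite exchange_big_nat/=; apply: eq_big_nat => l /andP[_ lL].
have b0 : (0 < b ^ l)%N by rewrite expn_gt0 ltnW.
have -> : (b ^ L = b ^ (L - l.+1) * b * b ^ l)%N.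
  by rewrite -mulnA -expnS -expnD subnK.
rewrite !sum_nat_block.
transitivity (\sum_(0 <= n < b ^ (L - l.+1) | (0 < n * b + d)%N)
  \sum_(0 <= r < b ^ l) count_jump k l r * ((n * b + d) * b ^ l + r)%:R^-1).
  rewrite [RHS]big_mkcond/=; apply: eq_bigr => n _.
  rewrite big_mkord (bigD1 (Ordinal db))//= [X in _ + X]big1 ?addr0; last first.
    move=> c cd; apply: big1_seq => r /=; rewrite mem_index_iota => /andP[_ rb].
    rewrite /digit divnMDl// (divn_small rb) addn0 modnMDl modn_small//.
    suff /negbTE -> : (c != d :> nat) by rewrite mul0r mulr0 if_same.
    by apply: contra cd => /eqP cd; apply/eqP/val_inj.
  rewrite (_ : (if _ then _ else _) = \sum_(0 <= r < b ^ l)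
     if (0 < n * b + d)%N then count_jump k l r * ((n * b + d) * b ^ l + r)%:R^-1
     else 0); last by case: ifP => // _; rewrite big1.
  apply: eq_big_nat => r /andP[_ rb].
  rewrite /digit divnMDl// (divn_small rb) addn0 modnMDl modn_small// eqxx mul1r.
  rewrite {1}/count_jump digit_count_low -/(count_jump k l r) mulrC.
  congr (if _ then _ else _).
  have [->|nd0] := posnP (n * b + d); first by rewrite mul0n add0n leqNgt rb.
  by rewrite (leq_trans _ (leq_addr _ _))// leq_pmull.
rewrite (sum_last_digit (fun N =>
  \sum_(0 <= r < b ^ l) count_jump k l r * (N * b ^ l + r)%:R^-1)).
rewrite exchange_big_nat/=; apply: eq_bigr => r _.
by rewrite mulr_sumr.
Qed.

End DigitCount.

(** * Masses of the levels of the string measure *)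

Section GeometricConvolution.
Variables (R : realType) (v : nat -> R) (q B : R).
Hypotheses (v0 : forall l, 0 <= v l) (vB : forall n, \sum_(0 <= l < n) v l <= B).
Hypotheses (q0 : 0 <= q) (q1 : q < 1).

Lemma nonneg_bounded_series_cvg (u : nat -> R) (C : R) :
  (forall l, 0 <= u l) -> (forall n, \sum_(0 <= l < n) u l <= C) ->
  u n @[n --> \oo] --> 0.
Proof.
move=> u0 uC; apply: cvg_series_cvg_0; apply: nondecreasing_is_cvgn.
  apply/nondecreasing_seqP => n.
  by rewrite /series/= big_nat_recr//= lerDl.
by exists C => _ [n _ <-]; exact: uC.
Qed.

Lemma geometric_convolution_cvg0 :
  \sum_(0 <= l < L) v l * q ^+ (L - l.+1) @[L --> \oo] --> 0.
Proof.
pose e L := \sum_(0 <= l < L) v l * q ^+ (L - l.+1).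
have e0 L : 0 <= e L by apply: sumr_ge0 => l _; rewrite mulr_ge0 ?exprn_ge0.
have eS L : e L.+1 = q * e L + v L.
  rewrite /e big_nat_recr//= subnn expr0 mulr1; congr +%R.
  rewrite mulr_sumr; apply: eq_big_nat => l /andP[_ lL].
  by rewrite subSS -(subnSK lL) exprS mulrCA.
apply: (@nonneg_bounded_series_cvg e (B / (1 - q))) => // n.
rewrite ler_pdivlMr ?subr_gt0// mulrBr mulr1 lerBlDr.
have [->|] := posnP n.
  by rewrite big_geq// mul0r addr0; have := vB 0; rewrite big_geq.
case: n => // n _.
have e00 : e 0%N = 0 by rewrite /e big_geq.
rewrite [leLHS]big_nat_recl//= e00 add0r.
under eq_bigr do rewrite eS.
rewrite big_split/= -mulr_sumr addrC lerD// mulrC ler_wpM2r//.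
by rewrite big_nat_recr//= lerDl.
Qed.

End GeometricConvolution.

Section StringWeights.
Variables (R : realType) (b d : nat).
Hypotheses (hb : (1 < b)%N) (db : (d < b)%N).

(** Proportion of the strings of length [l] with exactly [k] occurrences of [d],
that is, the mass of the level [l] of the string measure; strings of length [l]
are encoded as the integers below [b^l]. *)
Definition string_weight (k l : nat) : R :=
  b%:R ^- l * \sum_(0 <= r < b ^ l) (digit_count b d l r == k)%:R.

(** The same with [k - 1] occurrences, and zero when [k = 0]. *)
Definition string_weight_pred (k l : nat) : R :=
  b%:R ^- l * \sum_(0 <= r < b ^ l) ((digit_count b d l r).+1 == k)%:R.

Lemma string_weight_predS k : string_weight_pred k.+1 =1 string_weight k.
Proof. by move=> l; congr (_ * _); apply: eq_bigr => r _; rewrite eqSS. Qed.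

Lemma string_weight_pred0 : string_weight_pred 0 =1 fun=> 0.
Proof. by move=> l; rewrite /string_weight_pred big1 ?mulr0. Qed.

Lemma string_weight_ge0 k l : 0 <= string_weight k l.
Proof. by rewrite mulr_ge0 ?invr_ge0 ?exprn_ge0// sumr_ge0. Qed.

Lemma string_weight_pred_ge0 k l : 0 <= string_weight_pred k l.
Proof. by rewrite mulr_ge0 ?invr_ge0 ?exprn_ge0// sumr_ge0. Qed.

Let b_neq0 : b%:R != 0 :> R.
Proof. by rewrite pnatr_eq0 -lt0n ltnW. Qed.

Lemma string_weight0 k : string_weight k 0 = (k == 0%N)%:R.
Proof.
by rewrite /string_weight expr0 invr1 mul1r expn0 big_nat1 digit_count0 eq_sym.
Qed.

(** A string of length [l + 1] is one of length [l] followed by a digit, which is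
[d] for one choice out of [b]. *)
Lemma string_weightS k l :
  b%:R * string_weight k l.+1 =
  b%:R * string_weight k l + (string_weight_pred k l - string_weight k l).
Proof.
rewrite /string_weight /string_weight_pred exprS invfM mulrA mulVKf//.
rewrite mulrCA -mulrBr -mulrDr; congr (_ * _).
rewrite expnSr sum_nat_block mulr_sumr -sumrB -big_split/=.
apply: eq_bigr => N _; rewrite big_mkord (bigD1 (Ordinal db))//=.
rewrite digit_countS// modnMDl modn_small// eqxx.
rewrite divnMDl ?(ltnW hb)// divn_small// addn0 add1n.
rewrite [RHS]addrCA; congr +%R.
rewrite (eq_bigr (fun=> (digit_count b d l N == k)%:R)) => [|c cd].
  rewrite sumr_const cardC1 card_ord.
  have -> : b%:R = b.-1%:R + 1 :> R by rewrite natr1 prednK// ltnW.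
  by rewrite mulrDl mul1r addrK mulr_natl.
rewrite digit_countS// modnMDl modn_small// divnMDl ?(ltnW hb)// divn_small//.
suff /negbTE -> : (c != d :> nat) by rewrite addn0.
by apply: contra cd => /eqP cd; apply/eqP/val_inj.
Qed.

(** Mass carried by the strings of length less than [n], and its analogue for
[k - 1] occurrences. *)
Definition string_mass k n : R := \sum_(0 <= l < n) string_weight k l.
Definition string_mass_pred k n : R := \sum_(0 <= l < n) string_weight_pred k l.

Lemma string_massB k n :
  string_mass_pred k n - string_mass k n =
  b%:R * (string_weight k n - (k == 0%N)%:R).
Proof.
rewrite /string_mass /string_mass_pred; elim: n => [|n IH].
  by rewrite !big_geq// string_weight0 !subrr mulr0.
rewrite !big_nat_recr//= [RHS]mulrBr string_weightS.
move: IH; rewrite mulrBr; clear.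
by move: (\sum_(_ <= _ < _) _) (\sum_(_ <= _ < _) _) => s t; lra.
Qed.

Lemma string_mass0 n : string_mass 0 n = b%:R * (1 - string_weight 0 n).
Proof.
have := string_massB 0 n; rewrite /string_mass_pred.
under eq_bigr do rewrite string_weight_pred0.
by rewrite big1_eq sub0r => /(congr1 -%R); rewrite opprK -mulrN opprB.
Qed.

Lemma string_massS k n :
  string_mass k.+1 n = string_mass k n - b%:R * string_weight k.+1 n.
Proof.
have := string_massB k.+1 n; rewrite subr0 /string_mass_pred.
under eq_bigr do rewrite string_weight_predS.
by rewrite -/(string_mass k n) => <-; rewrite opprB addrC subrK.
Qed.

Lemma string_mass_le k n : string_mass k n <= b%:R.
Proof.
elim: k => [|k IH]; [rewrite string_mass0|rewrite string_massS].
  by rewrite ler_piMr ?ler0n// gerBl string_weight_ge0.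
by rewrite (le_trans _ IH)// gerBl mulr_ge0 ?string_weight_ge0.
Qed.

Lemma string_mass_pred_le k n : string_mass_pred k n <= b%:R.
Proof.
rewrite /string_mass_pred; case: k => [|k].
  by rewrite big1 ?ler0n// => l _; exact: string_weight_pred0.
by under eq_bigr do rewrite string_weight_predS; exact: string_mass_le.
Qed.

Lemma string_weight_cvg0 k : string_weight k n @[n --> \oo] --> 0.
Proof.
exact: (nonneg_bounded_series_cvg (string_weight_ge0 k) (string_mass_le k)).
Qed.

Lemma string_mass_cvg k : string_mass k n @[n --> \oo] --> (b%:R : R).
Proof.
elim: k => [|k IH].
  rewrite (_ : string_mass 0 = fun n => b%:R * (1 - string_weight 0 n)); last first.
    by apply/funext => n; exact: string_mass0.
  rewrite -[X in _ --> X]mulr1 -[X in _ * X]subr0.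
  apply: cvgMr; apply: cvgB; [exact: cvg_cst|exact: string_weight_cvg0].
rewrite (_ : string_mass k.+1 =
    fun n => string_mass k n - b%:R * string_weight k.+1 n); last first.
  by apply/funext => n; exact: string_massS.
rewrite -[X in _ --> X]subr0 -(mulr0 b%:R).
by apply: cvgB => //; apply: cvgMr; exact: string_weight_cvg0.
Qed.

(** Origin of the [b log b] term: these coefficients multiply [log b] in the
values of [psi] at the far ends of the blocks. *)
Lemma sum_string_weightB k L :
  \sum_(0 <= l < L) (string_weight_pred k l - string_weight k l) * (L - l.+1)%:R =
  b%:R * string_mass k L - (k == 0%N)%:R * b%:R * L%:R.
Proof.
elim: L => [|L IH]; first by rewrite /string_mass !big_geq// !mulr0 subrr.
rewrite big_nat_recr//= subnn mulr0 addr0.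
transitivity (\sum_(0 <= l < L)
    (string_weight_pred k l - string_weight k l) * (L - l.+1)%:R +
  (string_mass_pred k L - string_mass k L)).
  rewrite -sumrB -big_split/=; apply: eq_big_nat => l /andP[_ lL].
  by rewrite subSS -(subnSK lL) -natr1 mulrDr mulr1.
rewrite IH string_massB {2}/string_mass big_nat_recr//= -/(string_mass k L).
by rewrite -natr1; ring.
Qed.

End StringWeights.

(** * Limit of the partial sums *)

Section PartialSums.
Variables (R : realType) (b d : nat).
Hypotheses (hb : (1 < b)%N) (db : (d < b)%N).

(** The point [(d_1 + x)/b] with [x = r / b^l]. *)
Definition digamma_arg (l r : nat) : R :=
  ((least_pos_rep b d)%:R + r%:R / b%:R ^+ l) / b%:R.

Let bR0 : 0 < b%:R :> R.
Proof. by rewrite ltr0n ltnW. Qed.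

Let b_neq0 : b%:R != 0 :> R.
Proof. by rewrite gt_eqF. Qed.

Let bX0 l : 0 < b%:R ^+ l :> R.
Proof. exact: exprn_gt0. Qed.

Lemma least_pos_rep_gt0 : (0 < least_pos_rep b d)%N.
Proof. by rewrite /least_pos_rep; case: (ltnP 0 d) => // _; exact: ltnW. Qed.

Lemma digamma_arg_gt0 l r : 0 < digamma_arg l r.
Proof.
by rewrite divr_gt0// ltr_pwDl ?ltr0n ?least_pos_rep_gt0// divr_ge0// ltW.
Qed.

Lemma sum_inv_block l r M :
  \sum_(0 <= n < M) ((n * b + least_pos_rep b d) * b ^ l + r)%:R^-1 =
  b%:R ^- l * (b%:R^-1 * (digamma (digamma_arg l r + M%:R) -
                          digamma (digamma_arg l r))) :> R.
Proof.
rewrite digammaDn ?digamma_arg_gt0// addrC addKr big_mkord !mulr_sumr.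
apply: eq_bigr => n _; rewrite -!invfM; congr (_^-1).
rewrite natrD natrM natrD natrM natrX /digamma_arg.
by field; rewrite b_neq0 gt_eqF.
Qed.

Lemma digamma_near_ln (x z : R) : 0 < x -> x <= z -> z <= x + 1 ->
  `|digamma z - ln x| <= x^-1.
Proof.
move=> x0 xz zx; have z0 := lt_le_trans x0 xz.
have H1 := digamma_le x0 xz; have H2 := digamma_le z0 zx.
rewrite digammaS// in H2.
have H3 := digamma_le_ln x0; have H4 := digamma_ge_ln x0.
rewrite ler_norml; apply/andP; split.
  by rewrite lerBrDr addrC (le_trans H4).
by rewrite lerBlDl (le_trans H2)// lerD2r.
Qed.

(** The far end of a block lies between [b^j] and [b^j + 1]. *)
Lemma digamma_block_end l r j : (r < b ^ l)%N ->
  `|digamma (digamma_arg l r + (block_len b d j)%:R) - j%:R * ln b%:R|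
    <= b%:R ^- j.
Proof.
move=> rb; rewrite mulr_natl -lnXn//.
have x0 : 0 <= r%:R / b%:R ^+ l :> R by rewrite divr_ge0// ltW.
have x1 : r%:R / b%:R ^+ l <= 1 :> R.
  by rewrite ler_pdivrMr// mul1r -natrX ler_nat ltnW.
apply: digamma_near_ln => //; rewrite /digamma_arg /block_len /least_pos_rep;
  case: (ltnP 0 d) => d0.
- by rewrite -natrX lerDr divr_ge0// ?ltW// addr_ge0.
- rewrite mulrDl divff// -subn1 natrB ?expn_gt0 ?(ltnW hb)// natrX.
  by rewrite [1 + _]addrC -addrA [1 + _]addrC subrK lerDr divr_ge0// ltW.
- rewrite natrX [leLHS]addrC lerD2l ler_pdivrMr// mul1r.
  rewrite (@le_trans _ _ (d%:R + 1))// ?lerD2l// natr1 ler_nat//.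
- rewrite mulrDl divff// -subn1 natrB ?expn_gt0 ?(ltnW hb)// natrX.
  rewrite [1 + _]addrC -addrA [1 + _]addrC subrK addrC lerD2l.
  by rewrite ler_pdivrMr// mul1r (le_trans x1)// ler1n ltnW.
Qed.

(** The integral of [psi((d_1 + x)/b)] over the part of the string measure carried
by the strings of length less than [L]. *)
Definition digamma_sum (k L : nat) : R :=
  \sum_(0 <= l < L) b%:R ^- l * \sum_(0 <= r < b ^ l)
     (digit_count b d l r == k)%:R * digamma (digamma_arg l r).

(** The same for [k - 1] occurrences, and zero when [k = 0]. *)
Definition digamma_sum_pred (k L : nat) : R :=
  \sum_(0 <= l < L) b%:R ^- l * \sum_(0 <= r < b ^ l)
     ((digit_count b d l r).+1 == k)%:R * digamma (digamma_arg l r).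

(** Partial Kempner sum over the integers with at most [L] digits. *)
Definition kempner_partial (k L : nat) : R :=
  \sum_(0 <= m < b ^ L | count_mem d (digits b m) == k) m%:R^-1.

(* Error made in replacing psi by a multiple of log b at the far ends. *)
Let Z k L : R := \sum_(0 <= l < L) b%:R ^- l * \sum_(0 <= r < b ^ l)
  count_jump R b d k l r *
   (digamma (digamma_arg l r + (block_len b d (L - l.+1))%:R) -
    (L - l.+1)%:R * ln b%:R).

Let Z_cvg0 k : Z k L @[L --> \oo] --> 0.
Proof.
pose v l : R := string_weight R b d k l + string_weight_pred R b d k l.
pose e L := \sum_(0 <= l < L) v l * (b%:R^-1) ^+ (L - l.+1).
have Ze L : `|Z k L| <= e L.
  rewrite (le_trans (ler_norm_sum _ _ _))// /e; apply: ler_sum_nat => l /andP[_ lL].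
  rewrite normrM gtr0_norm ?invr_gt0// /v.
  rewrite /string_weight /string_weight_pred -mulrDr -mulrA.
  rewrite ler_wpM2l ?invr_ge0 ?(ltW (bX0 _))//.
  rewrite (le_trans (ler_norm_sum _ _ _))// -big_split mulr_suml/=.
  apply: ler_sum_nat => r /andP[_ rb].
  rewrite normrM ler_pM//; last by rewrite exprVn digamma_block_end.
  rewrite /count_jump (le_trans (ler_normB _ _))// addrC.
  by rewrite !normr_nat.
have e0 : e L @[L --> \oo] --> 0.
  apply: (@geometric_convolution_cvg0 _ v b%:R^-1 (b%:R + b%:R)).
  - by move=> l; rewrite addr_ge0 ?string_weight_ge0 ?string_weight_pred_ge0.
  - move=> n; rewrite big_split/= lerD//; first exact: string_mass_le.
    exact: string_mass_pred_le.
  - by rewrite invr_ge0 ltW.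
  - by rewrite invf_lt1// ltr1n.
apply/norm_cvg0P; apply: (@squeeze_cvgr _ _ _ _ (cst 0) e) => //.
  by near=> L; rewrite /= normr_ge0 Ze.
exact: cvg_cst.
Unshelve. all: by end_near. Qed.

(* Harmonic sum up to b^L. *)
Let H L : R := \sum_(0 <= m < b ^ L) m%:R^-1.

Let H_cvg : H L - L%:R * ln b%:R @[L --> \oo] --> - digamma (1 : R).
Proof.
have HE L : H L = digamma (b%:R ^+ L) - digamma 1.
  have : (0 < b ^ L)%N by rewrite expn_gt0 ltnW.
  rewrite /H -natrX; case: (b ^ L)%N => // n _.
  rewrite big_nat_recl//= invr0 add0r -nat1r digammaDn// addrC addKr big_mkord.
  by apply: eq_bigr => i _; rewrite -nat1r.
apply/cvgrPdist_le => e e0; near=> L.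
rewrite HE.
have -> : - digamma 1 - (digamma (b%:R ^+ L) - digamma 1 - L%:R * ln b%:R) =
   - (digamma (b%:R ^+ L) - L%:R * ln b%:R) :> R by ring.
rewrite normrN mulr_natl -lnXn//.
rewrite (le_trans (digamma_near_ln (bX0 L) (lexx _) _)) ?lerDl//.
near: L.
have : (b%:R^-1 : R) ^+ L @[L --> \oo] --> 0.
  by apply: cvg_expr; rewrite gtr0_norm ?invr_gt0// invf_lt1// ltr1n.
move=> /cvgrPdist_le/(_ e e0); apply: filterS => L.
by rewrite sub0r normrN exprVn gtr0_norm// invr_gt0.
Unshelve. all: by end_near. Qed.

Let partialE k L : kempner_partial k L =
  (k == 0%N)%:R * (H L - L%:R * ln b%:R) + b%:R^-1 * Z k L
   + ln b%:R * string_mass R b d k L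
   - b%:R^-1 * (digamma_sum_pred k L - digamma_sum k L).
Proof.
rewrite /kempner_partial kempner_partial_sum// -/(H L).
under eq_bigr do under eq_bigr do rewrite sum_inv_block.
pose A (l : nat) : R := \sum_(0 <= r < b ^ l) count_jump R b d k l r.
pose D (l : nat) : R := \sum_(0 <= r < b ^ l)
  count_jump R b d k l r * digamma (digamma_arg l r).
pose E (l : nat) : R := \sum_(0 <= r < b ^ l) count_jump R b d k l r *
   digamma (digamma_arg l r + (block_len b d (L - l.+1))%:R).
have ZE : Z k L = \sum_(0 <= l < L) b%:R ^- l * E l -
    ln b%:R * \sum_(0 <= l < L) (b%:R ^- l * A l) * (L - l.+1)%:R.
  rewrite mulr_sumr -sumrB; apply: eq_bigr => l _.
  rewrite mulrA [ln _ * _]mulrC -!mulrA -mulrBr; congr (_ * _).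
  rewrite /E /A mulr_suml -sumrB; apply: eq_bigr => r _.
  by rewrite mulrBr; congr (_ - _); ring.
have AE l :
    b%:R ^- l * A l = string_weight_pred R b d k l - string_weight R b d k l.
  by rewrite -mulrBr -sumrB.
have DE : digamma_sum_pred k L - digamma_sum k L =
    \sum_(0 <= l < L) b%:R ^- l * D l.
  rewrite -sumrB; apply: eq_bigr => l _; rewrite -mulrBr -sumrB; congr (_ * _).
  by apply: eq_bigr => r _; rewrite -mulrBl.
have -> : \sum_(0 <= l < L) \sum_(0 <= r < b ^ l) count_jump R b d k l r *
   (b%:R ^- l * (b%:R^-1 *
      (digamma (digamma_arg l r + (block_len b d (L - l.+1))%:R) -
       digamma (digamma_arg l r)))) =
   b%:R^-1 *
    (\sum_(0 <= l < L) b%:R ^- l * E l - \sum_(0 <= l < L) b%:R ^- l * D l).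
  rewrite -sumrB mulr_sumr; apply: eq_bigr => l _.
  rewrite -mulrBr /E /D -sumrB mulrA mulr_sumr; apply: eq_bigr => r _.
  by ring.
have SE : \sum_(0 <= l < L) (b%:R ^- l * A l) * (L - l.+1)%:R =
    b%:R * string_mass R b d k L - (k == 0%N)%:R * b%:R * L%:R.
  by rewrite -sum_string_weightB//; apply: eq_bigr => l _; rewrite AE.
rewrite ZE DE SE.
move: (\sum_(0 <= l < L) _) (\sum_(0 <= l < L) _) => s t.
by field.
Qed.

Lemma kempner_partial_cvg k :
  kempner_partial k L + b%:R^-1 * (digamma_sum_pred k L - digamma_sum k L)
    @[L --> \oo] --> (b%:R * ln b%:R - (k == 0%N)%:R * digamma 1 : R).
Proof.
rewrite (_ : (fun L => _) = fun L => (k == 0%N)%:R * (H L - L%:R * ln b%:R) +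
   b%:R^-1 * Z k L + ln b%:R * string_mass R b d k L); last first.
  by apply/funext => L; rewrite partialE subrK.
have -> : b%:R * ln b%:R - (k == 0%N)%:R * digamma 1 =
  (k == 0%N)%:R * (- digamma 1) + b%:R^-1 * 0 + ln b%:R * b%:R :> R by ring.
apply: cvgD; last by apply: cvgMr; exact: string_mass_cvg.
by apply: cvgD; apply: cvgMr; [exact: H_cvg|exact: Z_cvg0].
Qed.

End PartialSums.

(** * Integrals with respect to the string measures *)

Section StringsAsIntegers.
Variables (b : nat) (d : 'I_b).

Let b_gt0 : (0 < b)%N.
Proof. exact: leq_ltn_trans (ltn_ord d). Qed.

Lemma string_value_nil : string_value ([::] : seq 'I_b) = 0%N.
Proof. by rewrite /string_value big_ord0. Qed.

Lemma string_value_rcons (X : seq 'I_b) c :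
  string_value (rcons X c) = (string_value X * b + c)%N.
Proof.
rewrite /string_value rev_rcons size_rcons big_ord_recl/= expn0 muln1 addnC.
congr addn; rewrite big_distrl/=; apply: eq_bigr => i _.
by rewrite expnSr mulnA.
Qed.

Lemma string_value_lt (X : seq 'I_b) : (string_value X < b ^ size X)%N.
Proof.
elim/last_ind: X => [|X c IH]; first by rewrite string_value_nil.
rewrite string_value_rcons size_rcons expnSr.
rewrite (@leq_trans ((string_value X).+1 * b))//; last by rewrite leq_mul2r IH orbT.
by rewrite mulSn addnC ltn_add2r.
Qed.

Lemma digit_count_string_value (hb : (1 < b)%N) (X : seq 'I_b) :
  digit_count b d (size X) (string_value X) = count_mem d X.
Proof.
elim/last_ind: X => [|X c IH]; first by rewrite digit_count0.
rewrite string_value_rcons size_rcons digit_countS// modnMDl modn_small//.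
by rewrite divnMDl// divn_small// addn0 IH -cats1 count_cat/= addn0 addnC.
Qed.

Lemma string_value_inj (X Y : seq 'I_b) :
  size X = size Y -> string_value X = string_value Y -> X = Y.
Proof.
elim/last_ind: X Y => [|X c IH] Y; first by move/esym/size0nil.
case/lastP: Y => [|Y e]; first by rewrite size_rcons.
rewrite !size_rcons !string_value_rcons => -[sXY] E.
have Ec : c = e.
  apply/val_inj; move: E => /(congr1 (modn^~ b)).
  by rewrite !modnMDl !modn_small.
rewrite Ec (IH Y)//; move: E => /(congr1 (divn^~ b)).
by rewrite !divnMDl// !divn_small// !addn0.
Qed.

Lemma string_value_surj l r : (r < b ^ l)%N ->
  exists2 X : seq 'I_b, size X = l & string_value X = r.
Proof.
elim: l r => [|l IH] r rb.
  exists [::] => //; rewrite string_value_nil.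
  by move: rb; rewrite expn0 ltnS leqn0 => /eqP.
have [|X sX vX] := IH (r %/ b)%N; first by rewrite ltn_divLR// -expnSr.
exists (rcons X (Ordinal (ltn_pmod r b_gt0))); first by rewrite size_rcons sX.
by rewrite string_value_rcons vX/= -divn_eq.
Qed.

(** Strings are encoded as pairs of a length [l] and an integer below [b^l]. *)
Lemma string_size_value_bij :
  set_bij [set: seq 'I_b] ([set: nat] `*`` (fun l => `I_(b ^ l)))
    (fun X => (size X, string_value X)).
Proof.
split => [X _|X Y _ _ [+ +]|[l r] [_ /= rb]].
- by split => //=; exact: string_value_lt.
- exact: string_value_inj.
- by have [X <- <-] := string_value_surj rb; exists X.
Qed.

End StringsAsIntegers.

Section StringMeasureLevels.
Variables (R : realType) (b : nat) (d : 'I_b) (k : nat).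
Hypothesis hb : (1 < b)%N.

Let w (l r : nat) : R := b%:R ^- l * (digit_count b d l r == k)%:R.

Let w_ge0 l r : 0 <= w l r.
Proof. by rewrite mulr_ge0 ?invr_ge0 ?exprn_ge0. Qed.

Let pt (l r : nat) : measurableTypeR R := r%:R / b%:R ^+ l.

Let level (l : nat) : {measure set (measurableTypeR R) -> \bar R} :=
  msum (fun r => mscale (NngNum (w_ge0 l r)) \d_(pt l r)) (b ^ l).

(** The string measure as a series, over the levels, of finite sums of weighted
Dirac masses. *)
Lemma string_measureE (A : set (measurableTypeR R)) :
  string_measure R d k A =
  (\sum_(l <oo) \sum_(r < b ^ l) (w l r)%:E * \d_(pt l r) A)%E.
Proof.
pose a l r : \bar R := ((w l r)%:E * \d_(pt l r) A)%E.
have a0 l r : (0 <= a l r)%E by rewrite mule_ge0 ?lee_fin.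
rewrite /string_measure esum_mkcond.
transitivity (\esum_(X in [set: seq 'I_b]) a (size X) (string_value X)).
  apply: eq_esum => X _; rewrite /a /w /pt digit_count_string_value//.
  case: ifPn => [/[!inE] ->|]; first by rewrite eqxx mulr1.
  rewrite notin_setE/= => /eqP/negbTE ->; by rewrite mulr0 mul0e.
rewrite -(reindex_esum _ _ _ (fun z => a z.1 z.2) (string_size_value_bij d)).
rewrite -(@esum_esum _ _ _ _ _ (fun l r => a l r))//.
rewrite nneseries_esumT; last by move=> l; apply: sume_ge0 => r _; exact: a0.
apply: eq_esum => l _; rewrite esum_fset//.
by rewrite -fsbig_ord.
Qed.

Lemma ge0_string_measure_integral_cvg (f : R -> R) :
  (forall x, `[0, 1[%classic x -> 0 <= f x) ->
  measurable_fun (`[0, 1[%classic : set (measurableTypeR R)) f ->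
  (\sum_(0 <= l < L) b%:R ^- l * \sum_(0 <= r < b ^ l)
     (digit_count b d l r == k)%:R * f (r%:R / b%:R ^+ l))%:E @[L --> \oo] -->
  (\int[string_measure R d k]_(x in `[0%R, 1%R[) (f x)%:E)%E.
Proof.
move=> f0 mf.
have f0' x : `[0, 1[%classic x -> (0%R <= (f x)%:E)%E.
  by move=> /f0; rewrite lee_fin.
have mf' : measurable_fun (`[0, 1[%classic : set (measurableTypeR R)) (EFin \o f).
  exact/measurable_EFinP.
have mD : measurable (`[0, 1[%classic : set (measurableTypeR R)).
  exact: measurable_itv.
have -> : (\int[string_measure R d k]_(x in `[0%R, 1%R[) (f x)%:E =
   \int[mseries level 0]_(x in `[0%R, 1%R[) (f x)%:E)%E.
  by apply: eq_measure_integral => A _ _; exact: string_measureE.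
rewrite ge0_integral_measure_series//.
have levelE l : (\int[level l]_(x in `[0%R, 1%R[) (f x)%:E =
  (b%:R ^- l * \sum_(0 <= r < b ^ l)
     (digit_count b d l r == k)%:R * f (r%:R / b%:R ^+ l))%:E)%E.
  rewrite ge0_integral_measure_sum// big_mkord mulr_sumr -sumEFin.
  apply: eq_bigr => r _; rewrite ge0_integral_mscale// integral_dirac//=.
  rewrite diracE mem_set ?mul1e/=; first by rewrite -EFinM mulrA.
  have bl0 : 0 < b%:R ^+ l :> R by rewrite exprn_gt0// ltr0n ltnW.
  rewrite in_itv/= divr_ge0 ?(ltW bl0)//= ltr_pdivrMr// mul1r -natrX ltr_nat.
  exact: ltn_ord.
rewrite (_ : (fun L => _) = (fun L => \sum_(0 <= l < L)
   \int[level l]_(x in `[0%R, 1%R[) (f x)%:E)%E); last first.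
  apply/funext => L; rewrite -sumEFin; apply: eq_bigr => l _.
  by rewrite levelE.
apply: is_cvg_nneseries => l _ _; exact: integral_ge0.
Qed.

End StringMeasureLevels.

Section BoundedIntegrals.
Variables (R : realType).
Local Notation T := (measurableTypeR R).
Variables (D : set T) (f : R -> R).
Hypotheses (mD : measurable D) (mf : measurable_fun D f)
  (bf : [bounded f x | x in D]).

Lemma finite_measure_bounded_integrable
    (mu : {finite_measure set T -> \bar R}) : mu.-integrable D (EFin \o f).
Proof.
apply: measurable_bounded_integrable => //.
by rewrite ltey_eq fin_num_measure.
Qed.

(** The Jordan decomposition [p - n] of [mu - nu] satisfies [mu + n = nu + p]. *)
Lemma charge_integralB (mu nu : {finite_measure set T -> \bar R}) :
  charge_integral (cadd (charge_of_finite_measure mu)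
                    (copp (charge_of_finite_measure nu))) D (EFin \o f) =
  (\int[mu]_(x in D) (f x)%:E - \int[nu]_(x in D) (f x)%:E)%E.
Proof.
rewrite /charge_integral; set PN := (X in jordan_pos X).
pose p : {finite_measure set T -> \bar R} := jordan_pos PN.
pose n : {finite_measure set T -> \bar R} := jordan_neg PN.
rewrite -[jordan_pos PN]/(p : set T -> \bar R).
rewrite -[jordan_neg PN]/(n : set T -> \bar R).
have I (m : {finite_measure set T -> \bar R}) :=
  finite_measure_bounded_integrable m.
have pnE (A : set T) : measurable A -> (mu A + n A = nu A + p A)%E.
  move=> mA.
  have : (mu A - nu A = p A - n A)%E.
    have := jordan_decomp PN mA.
    by rewrite -[RHS]/(p A + cscale (-1) n A)%E cscaleN1.
  have := fin_num_measure mu A mA; have := fin_num_measure nu A mA.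
  have := fin_num_measure p A mA; have := fin_num_measure n A mA.
  move=> /fineK nf /fineK pf /fineK nuf /fineK muf.
  rewrite -nf -pf -nuf -muf -!EFinB => -[].
  move: (fine _) (fine _) (fine _) (fine _) => x y u v E.
  by rewrite -!EFinD; congr EFin; move: E; clear; lra.
have E : (\int[measure_add mu n]_(x in D) (f x)%:E =
          \int[measure_add nu p]_(x in D) (f x)%:E)%E.
  apply: eq_measure_integral => A mA _.
  by rewrite [LHS]measure_addE [RHS]measure_addE pnE.
rewrite !integral_measure_add// in E; [|exact: I..].
have F (m : {finite_measure set T -> \bar R}) :
  (\int[m]_(x in D) (f x)%:E)%E \is a fin_num.
  by apply: integrable_fin_num => //; exact: I.
move: E; have := F mu; have := F nu; have := F p; have := F n.
move=> /fineK nf /fineK pf /fineK nuf /fineK muf.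
rewrite -nf -pf -nuf -muf -!EFinD => -[].
move: (fine _) (fine _) (fine _) (fine _) => x y u v E.
by congr EFin; move: E; clear; lra.
Qed.

End BoundedIntegrals.

(** * Kempner sums as digamma integrals *)

Section Limits.
Variables (R : realType) (b : nat) (d : 'I_b).
Hypothesis hb : (1 < b)%N.

(** Along the subsequence of the powers of [b], the partial sums give the whole
Kempner sum. *)
Lemma kempner_sum_cvg k :
  (kempner_partial R b d k L)%:E @[L --> \oo] --> kempner_sum R b d k.
Proof.
pose P m := (0 < m)%N && (count_mem (val d) (digits b m) == k).
pose a (m : nat) : \bar R := (m%:R^-1)%:E.
have a0 m : (0 <= a m)%E by rewrite lee_fin invr_ge0.
have -> : kempner_sum R b d k = (\sum_(m <oo | P m) a m)%E.
  rewrite nneseries_esum//; congr (esum _ _); apply/seteqP; split => m /=.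
    by move=> [m0 /eqP mk]; apply/andP.
  by move=> /andP[m0 /eqP].
rewrite (_ : (fun L => _) = (fun n => \sum_(0 <= m < n | P m) a m)%E \o expn b).
  apply: (@cvg_comp _ _ _ (expn b) _ _ \oo).
    apply/cvgnyPge => A; near=> L; rewrite (@leq_trans L)//.
      by near: L; exact: nbhs_infty_ge.
    exact/ltnW/ltn_expl.
  by apply: is_cvg_nneseries => m _ _.
apply/funext => L /=; rewrite sumEFin; congr EFin.
rewrite /kempner_partial [LHS]big_mkcond [RHS]big_mkcond/=.
by apply: eq_bigr => -[|m] _; rewrite /P//= invr0 if_same.
Unshelve. all: by end_near. Qed.

Let f (x : R) : R := digamma (((least_pos_rep b d)%:R + x) / b%:R).

Let f_le x y : 0 <= x -> x <= y -> f x <= f y.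
Proof.
move=> x0 xy; apply: digamma_le.
  by rewrite divr_gt0 ?ltr0n ?ltr_pwDl ?ltr0n ?least_pos_rep_gt0// ltnW.
by rewrite ler_pM2r ?invr_gt0 ?ltr0n ?(ltnW hb)// lerD2l.
Qed.

Let mf : measurable_fun (`[0, 1[%classic : set (measurableTypeR R)) f.
Proof.
have mg : measurable_fun (`[0, 1[%classic : set (measurableTypeR R))
    (fun x => f (Num.max x 0)).
  (* monotone only on the half-line, hence the truncation at 0 *)
  apply: nondecreasing_measurable; first exact: measurable_itv.
  move=> x y xy; apply: f_le; first by rewrite le_max lexx orbT.
  by rewrite ge_max !le_max xy lexx orbT.
apply: eq_measurable_fun mg => x; rewrite inE/= in_itv/= => /andP[x0 _].
by rewrite max_l.
Qed.

Let bf : [bounded f x | x in `[0, 1[%classic].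
Proof.
exists (Num.max `|f 0| `|f 1|); split; first exact: num_real.
move=> M; rewrite gt_max => /andP[M0 M1] x /=; rewrite in_itv/= => /andP[x0 x1].
rewrite ler_norml; apply/andP; split.
  rewrite (le_trans _ (f_le (lexx 0) x0))// lerNl (le_trans _ (ltW M0))//.
  by rewrite -normrN ler_norm.
by rewrite (le_trans (f_le x0 (ltW x1)))// (le_trans (ler_norm _))// ltW.
Qed.

Lemma digamma_integrand_bounded :
  [/\ measurable (`[0, 1[%classic : set (measurableTypeR R)),
      measurable_fun (`[0, 1[%classic : set (measurableTypeR R))
        (fun x : R => digamma (((least_pos_rep b d)%:R + x) / b%:R)) &
      [bounded digamma (((least_pos_rep b d)%:R + x) / b%:R) : R |
        x in `[0, 1[%classic]].
Proof. by split; [exact: measurable_itv|exact: mf|exact: bf]. Qed.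

Lemma string_integral_cvg k :
  (digamma_sum R b d k L)%:E @[L --> \oo] -->
  (\int[string_measure R d k]_(x in `[0%R, 1%R[) (f x)%:E)%E.
Proof.
pose S (g : R -> R) L : R := \sum_(0 <= l < L) b%:R ^- l * \sum_(0 <= r < b ^ l)
     (digit_count b d l r == k)%:R * g (r%:R / b%:R ^+ l).
pose fp x := Num.max (f x) 0; pose fn x := Num.max (- f x) 0.
have mD : measurable (`[0, 1[%classic : set (measurableTypeR R)).
  exact: measurable_itv.
have cp := @ge0_string_measure_integral_cvg R b d k hb fp.
have cn := @ge0_string_measure_integral_cvg R b d k hb fn.
have If := finite_measure_bounded_integrable mD mf bf (string_measure R d k).
rewrite integralE.
have pE : (\int[string_measure R d k]_(x in `[0%R, 1%R[) (fun x => (f x)%:E)^\+ x =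
   \int[string_measure R d k]_(x in `[0%R, 1%R[) (fp x)%:E)%E.
  by apply: eq_integral => x _; rewrite funeposE -EFin_max.
have nE : (\int[string_measure R d k]_(x in `[0%R, 1%R[) (fun x => (f x)%:E)^\- x =
   \int[string_measure R d k]_(x in `[0%R, 1%R[) (fn x)%:E)%E.
  by apply: eq_integral => x _; rewrite funenegE -EFinN -EFin_max.
rewrite (_ : (fun L => _) = (fun L => (S fp L)%:E - (S fn L)%:E)%E); last first.
  apply/funext => L; rewrite -EFinB; congr EFin.
  rewrite /S -sumrB; apply: eq_bigr => l _; rewrite -mulrBr; congr (_ * _).
  rewrite -sumrB; apply: eq_bigr => r _; rewrite -mulrBr; congr (_ * _).
  rewrite /fp /fn -[digamma _]/(f (r%:R / b%:R ^+ l)).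
  have [f0|/ltW f0] := leP 0 (f (r%:R / b%:R ^+ l)).
    by rewrite max_r ?oppr_le0// subr0.
  by rewrite max_l ?oppr_ge0// sub0r opprK.
apply: cvgeB.
- by apply: fin_num_adde_defr; exact: (integrable_pos_fin_num mD If).
- by rewrite pE; apply: cp => [x _|]; [rewrite le_max lexx orbT|
    exact: measurable_maxr].
- rewrite nE; apply: cn => [x _|]; first by rewrite le_max lexx orbT.
  by apply: measurable_maxr => //; exact: measurableT_comp.
Qed.

(** Both formulas at once, the measure of index [- 1] being zero. *)
Lemma kempner_sum_digamma (k : nat) :
  (kempner_sum R b d k = (b%:R * ln b%:R - (k == 0%N)%:R * digamma 1)%:E +
    (b%:R^-1)%:E *
     (\int[string_measure R d k]_(x in `[0%R, 1%R[) (f x)%:E -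
      (if k is k'.+1 then
        \int[string_measure R d k']_(x in `[0%R, 1%R[) (f x)%:E else 0)))%E.
Proof.
have mD : measurable (`[0, 1[%classic : set (measurableTypeR R)).
  exact: measurable_itv.
pose J j := fine (\int[string_measure R d j]_(x in `[0%R, 1%R[) (f x)%:E)%E.
have JE k' :
    (\int[string_measure R d k']_(x in `[0%R, 1%R[) (f x)%:E)%E = (J k')%:E.
  rewrite fineK//; apply: integrable_fin_num => //.
  exact: (finite_measure_bounded_integrable mD mf bf (string_measure R d k')).
have Jcvg k' : digamma_sum R b d k' L @[L --> \oo] --> J k'.
  by have := @string_integral_cvg k'; rewrite JE => /fine_cvg.
have [J' J'cvg J'E] : exists2 J' : R,
    digamma_sum_pred R b d k L @[L --> \oo] --> J' &
    (if k is k'.+1 then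
       \int[string_measure R d k']_(x in `[0%R, 1%R[) (f x)%:E else 0)%E = J'%:E.
  case: (k) => [|k']; last by exists (J k'); [exact: Jcvg|exact: JE].
  exists 0 => //; rewrite (_ : digamma_sum_pred R b d 0 = cst 0).
    exact: cvg_cst.
  apply/funext => L; rewrite /digamma_sum_pred big1// => l _.
  by rewrite big1 ?mulr0// => r _; rewrite mul0r.
have K := @kempner_partial_cvg R b d hb (ltn_ord d) k.
have {}K : kempner_partial R b d k L @[L --> \oo] -->
   b%:R * ln b%:R - (k == 0%N)%:R * digamma 1 - b%:R^-1 * (J' - J k).
  rewrite (_ : kempner_partial R b d k = fun L => kempner_partial R b d k L +
    b%:R^-1 * (digamma_sum_pred R b d k L - digamma_sum R b d k L) -
    b%:R^-1 * (digamma_sum_pred R b d k L - digamma_sum R b d k L)); last first.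
    by apply/funext => L; rewrite addrK.
  by apply: cvgB => //; apply: cvgMr; apply: cvgB => //; exact: Jcvg.
rewrite -(cvg_lim _ (@kempner_sum_cvg k))//.
rewrite (cvg_lim _ (cvg_EFin _ K))//; last exact: nearW.
rewrite JE J'E.
by rewrite -EFinB -EFinM -EFinD -[J k - J']opprB mulrN.
Qed.

End Limits.

Theorem proposition5 (R : realType) (b : nat) (d : 'I_b) (hb : (2 <= b)%N) :
  let d1 : nat := if (0 < d)%N then val d else b in
  let mu (k : nat) : {finite_measure set (measurableTypeR R) -> \bar R} :=
    string_measure R d k in
  let f (x : R) : \bar R := (digamma ((d1%:R + x) / b%:R))%:E in
  (forall k : nat, (1 <= k)%N ->
     kempner_sum R b d k =
       ((b%:R * ln b%:R)%:E
        + (b%:R^-1)%:E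
          * charge_integral
              (cadd (charge_of_finite_measure (mu k))
                    (copp (charge_of_finite_measure (mu k.-1))))
              `[0%R, 1%R[ f)%E)
  /\ kempner_sum R b d 0 =
       ((b%:R * ln b%:R - digamma 1)%:E
        + (b%:R^-1)%:E * \int[mu 0%N]_(x in `[0%R, 1%R[) f x)%E.
Proof.
move=> d1 mu f; split; last first.
  by rewrite kempner_sum_digamma// mul1r sube0.
case=> // k _.
rewrite kempner_sum_digamma// mul0r subr0.
have [mD mf bf] := digamma_integrand_bounded R d hb.
by rewrite (charge_integralB mD mf bf).
Qed.
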